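(* Fix $\varepsilon\in(0,1)$ and define $V=1/\varepsilon$. If the problem is feasible and the Lagrange multiplier (non-vertical separating hyperplane) assumption stated in the context holds, then under the proposed algorithm with this $V$, for all $T\ge1/\varepsilon^2$, $$\frac1T\sum_{t=0}^{T-1}\sum_{n=1}^N\mathbb E[y^n[t]]\le f_*+\mathcal O(\varepsilon),$$ $$\frac1T\sum_{t=0}^{T-1}\sum_{n=1}^N\mathbb E[z_l^n[t]]\le d_l+\mathcal O(\varepsilon),\qquad l\in\{1,2,\dots,L\}.$$ Thus the algorithm provides an $\mathcal O(\varepsilon)$ approximation with convergence time $\mathcal O(1/\varepsilon^2)$. (Here $\mathcal O(\varepsilon)$ denotes a quantity bounded by a constant, not depending on $\varepsilon$ or $T$, times $\varepsilon$.)
   Context: **Model.** Time is slotted, $t\in\{0,1,2,\dots\}$. There are $N$ renewal systems. The timeline of system $n$ is divided into back-to-back renewal frames; $t_k^n$ is the slot of the $k$-th renewal, $t^n_0=0$, $T_k^n=t_{k+1}^n-t_k^n$ is a (random) positive integer, and $\mathcal T_k^n=\{t_k^n,\dots,t_{k+1}^n-1\}$. At time $t_k^n$ system $n$ chooses a (possibly random, possibly based on the past of all systems) action $\alpha_k^n\in\mathcal A^n$, which determines the distributions of the frame length $T_k^n$, of the performance vectors $\mathbf z^n[t]=(z_1^n[t],\dots,z_L^n[t])$ and of the penalties $y^n[t]$, $t\in\mathcal T_k^n$. Renewal property: given $\alpha_k^n=\alpha^n$, the variables $T_k^n$, $\mathbf z^n[t]$, $y^n[t]$ ($t\in\mathcal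 T^n_k$) are independent of the information of all systems from the slots before $t_k^n$, with known conditional expectations $\widehat T^n(\alpha^n)=\mathbb E[T_k^n|\alpha_k^n=\alpha^n]$, $\widehat y^n(\alpha^n)=\mathbb E[\sum_{t\in\mathcal T_k^n}y^n[t]\,|\,\alpha_k^n=\alpha^n]$, $\widehat{\mathbf z}^n(\alpha^n)=\mathbb E[\sum_{t\in\mathcal T_k^n}\mathbf z^n[t]\,|\,\alpha_k^n=\alpha^n]$ not depending on $k$. There is an uncontrollable external process $\{\mathbf d[t]\}_{t\ge0}\subseteq\mathbb R^L$, i.i.d. over slots (with $\mathbf d[t]$ independent of the history before slot $t$), with $d_l=\mathbb E[d_l[t]]$. **Problem.** Minimize $\limsup_{T\to\infty}\frac1T\sum_{t=0}^{T-1}\sum_{n=1}^N\mathbb E[y^n[t]]$ subject to $\limsup_{T\to\infty}\frac1T\sum_{t=0}^{T-1}\sum_{n=1}^N\mathbb E[z_l^n[t]]\le d_l$ for $l=1,\dots,L$. The problem is feasible if some decision sequences satisfy the constraints; $f_*$ denotes the infimum objective value over all decision sequences satisfying the constraints. **Standing assumptions.** (a) There are constants $y_{\max},z_{\max},d_{\max}$ with $|y^n[t]|\le y_{\max}$, $|z_l^n[t]|\le z_{\max}$, $|d_l[t]|\le d_{\max}$ for all $n,t,l$; and there is a constant $B\ge1$ such that for all $n$, $k$, every $\alpha^n\in\mathcal A^n$ and every $s\in\mathbb N$ with $\Pr(T_k^n\ge s|\alpha_k^n=\alpha^n)>0$, $\mathbb E[(T_k^n-s)^2\,|\,\alpha_k^n=\alpha^n,T_k^n\ge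 s]\le B$. (b) With $\widehat f^n(\alpha^n)=\widehat y^n(\alpha^n)/\widehat T^n(\alpha^n)$ and $\widehat{\mathbf g}^n(\alpha^n)=\widehat{\mathbf z}^n(\alpha^n)/\widehat T^n(\alpha^n)$, the set $\{(\widehat f^n(\alpha^n),\widehat{\mathbf g}^n(\alpha^n)):\alpha^n\in\mathcal A^n\}$ is compact for each $n$. **Performance region.** $\mathcal S^n\subseteq\mathbb R^{L+2}$ is the convex hull of $\{(\widehat y^n(\alpha^n),\widehat{\mathbf z}^n(\alpha^n),\widehat T^n(\alpha^n)):\alpha^n\in\mathcal A^n\}$ and $\mathcal P^n=\{(y/T,\mathbf z/T):(y,\mathbf z,T)\in\mathcal S^n\}\subseteq\mathbb R^{L+1}$. **Lagrange multiplier assumption.** There exist non-negative finite constants $\gamma_1,\dots,\gamma_L$ such that $$\sum_{n=1}^N\overline f^n+\sum_{l=1}^L\gamma_l\sum_{n=1}^N\overline g^n_l\ \ge\ f_*+\sum_{l=1}^L\gamma_ld_l\qquad\text{for all }(\overline f^n,\overline{\mathbf g}^n)\in\mathcal P^n,\ n=1,\dots,N.$$ **Proposed algorithm** (parameter $V>0$). Virtual queues $\mathbf Q[t]=(Q_1[t],\dots,Q_L[t])$ with $Q_l[0]=0$. At the beginning of the $k$-th frame of system $n$, system $n$ observes $\mathbf Q[t_k^n]$ and chooses $\alpha_k^n\in\mathcal A^n$ minimizing $V\widehat f^n(\alpha^n)+\langle\mathbf Q[t_k^n],\widehat{\mathbf g}^n(\alpha^n)\rangle$ over $\alpha^n\in\mathcal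 A^n$. After each slot, $Q_l[t+1]=\max\{Q_l[t]+\sum_{n=1}^Nz_l^n[t]-d_l[t],0\}$ for all $l$. *)

(* Defs.v *)
From HB Require Import structures.
From mathcomp Require Export all_boot all_order all_algebra.
From mathcomp Require Export all_classical all_reals all_analysis.

Set Implicit Arguments.
Unset Strict Implicit.
Unset Printing Implicit Defensive.

Import Order.TTheory GRing.Theory Num.Theory.
Export numFieldNormedType.Exports.

Local Open Scope classical_set_scope.
Local Open Scope ring_scope.

(* A frame is recorded as the list of its per-slot values (penalty, performance
   vector); the frame length T is the size of that list.  Such lists carry the
   sigma-algebra generated by the length and by the coordinates. *)
Definition slot (R : realType) (L : nat) := (R * L.-tuple R)%type.

Definition frame_cylinders (R : realType) (L : nat) : set (set (seq (slot R L))) :=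
  [set C | (exists s : nat, C = [set w | size w = s]) \/
           (exists j : nat, exists2 B : set (slot R L), measurable B &
              C = [set w | B (nth point w j)])].

HB.instance Definition _ (R : realType) (L : nat) :=
  isPointed.Build (seq (slot R L)) [::].

Definition frame (R : realType) (L : nat) :=
  g_sigma_algebraType (@frame_cylinders R L).

Section Model.
Context {R : realType} {N L : nat} {dA : 'I_N -> measure_display}.
Context {A : forall n : 'I_N, measurableType (dA n)}.

(* [frame_law n k a] is the distribution of the k-th frame of system n under
   the action a.  Only the three conditional expectations are required not to
   depend on k. *)
Record renewal_model := RenewalModel {
  frame_law : forall n : 'I_N, nat -> R.-pker (A n) ~> (frame R L);
  mean_length : forall n : 'I_N, A n -> R;
  mean_penalty : forall n : 'I_N, A n -> R;
  mean_perf : forall n : 'I_N, A n -> 'rV[R]_L;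
  ext_law : probability (L.-tuple R) R
}.

Implicit Types M : renewal_model.

Definition frame_length (w : frame R L) : nat := size w.
Definition frame_penalty (w : frame R L) : R := \sum_(v <- w) v.1.
Definition frame_perf (l : 'I_L) (w : frame R L) : R := \sum_(v <- w) tnth v.2 l.

Definition ext_mean M (l : 'I_L) : R := (\int[ext_law M]_x tnth x l)%R.

Definition frame_law_spec M : Prop :=
  forall (n : 'I_N) (k : nat) (a : A n),
    [/\ frame_law M n k a [set w | frame_length w = 0%N] = 0%E,
        (\int[frame_law M n k a]_w (frame_length w)%:R%:E
           = (mean_length M a)%:E)%E,
        (\int[frame_law M n k a]_w (frame_penalty w)%:E
           = (mean_penalty M a)%:E)%E &
        forall l, (\int[frame_law M n k a]_w (frame_perf l w)%:E
           = (mean_perf M a 0 l)%:E)%E].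

Definition event_mean {d} {T : measurableType d} (mu : {measure set T -> \bar R})
    (E : set T) (f : T -> R) : \bar R :=
  (((fine (mu E))^-1)%:E * \int[mu]_(w in E) (f w)%:E)%E.

(* Boundedness is imposed on the laws, hence almost surely on every run. *)
Definition bounded_values M : Prop :=
  exists ymax zmax dmax : R,
    (forall (n : 'I_N) (k : nat) (a : A n),
       {ae frame_law M n k a, forall w : frame R L, forall v, v \in (w : seq _) ->
          `|v.1| <= ymax /\ forall l, `|tnth v.2 l| <= zmax}) /\
    {ae ext_law M, forall x, forall l, `|tnth x l| <= dmax}.

Definition bounded_residual_lifetimes M : Prop :=
  exists2 B : R, 1 <= B &
    forall (n : 'I_N) (k : nat) (a : A n) (s : nat),
      let E := [set w | (s <= frame_length w)%N] in
      (0 < frame_law M n k a E)%E ->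
      (event_mean (frame_law M n k a) E
         (fun w => ((frame_length w)%:R - s%:R) ^+ 2)%R <= B%:E)%E.

Definition fhat M (n : 'I_N) (a : A n) : R := mean_penalty M a / mean_length M a.
Definition ghat M (n : 'I_N) (a : A n) : 'rV[R]_L :=
  (mean_length M a)^-1 *: mean_perf M a.

Definition compact_ratios M : Prop :=
  forall n : 'I_N,
    compact [set p : R * 'rV[R]_L | exists a : A n, p = (fhat M a, ghat M a)].

Definition standing_assumptions M : Prop :=
  [/\ frame_law_spec M, bounded_values M, bounded_residual_lifetimes M &
      compact_ratios M].

Definition convex_hull (V : lmodType R) (X : set V) : set V :=
  [set v | exists m (c : 'I_m -> R) (x : 'I_m -> V),
     [/\ forall i, 0 <= c i, \sum_i c i = 1, forall i, X (x i) &
         v = \sum_i c i *: x i]].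

Definition region_S M (n : 'I_N) : set (R^o * 'rV[R]_L * R^o) :=
  convex_hull [set p | exists a : A n,
    p = (mean_penalty M a, mean_perf M a, mean_length M a)].

Definition region_P M (n : 'I_N) : set (R * 'rV[R]_L) :=
  [set p | exists2 q, region_S M n q & p = (q.1.1 / q.2, q.2^-1 *: q.1.2)].

(* The random evolution of all systems and of the external process, indexed by
   frame ([renewal], [action]) or by slot ([penalty], [perf], [ext]). *)
Record evolution (Omega : Type) := Evolution {
  renewal : 'I_N -> nat -> Omega -> nat;
  action : forall n : 'I_N, nat -> Omega -> A n;
  penalty : 'I_N -> nat -> Omega -> R;
  perf : 'I_N -> nat -> Omega -> L.-tuple R;
  ext : nat -> Omega -> L.-tuple R
}.

Definition frame_of (Omega : Type) (X : evolution Omega) (n : 'I_N) (k : nat)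
    (w : Omega) : frame R L :=
  [seq (penalty X n t w, perf X n t w)
     | t <- iota (renewal X n k w) (renewal X n k.+1 w - renewal X n k w)].

(* Information of all systems from the slots before t.  Whether a renewal
   happens at slot t itself is settled by the frames that ended before t; the
   action then taken at slot t is not part of it. *)
Definition history (Omega : Type) (X : evolution Omega) (t : nat) :
    set (set Omega) :=
  <<s [set H |
    [\/ exists n s (B : set R),
          [/\ (s < t)%N, measurable B & H = penalty X n s @^-1` B],
        exists n s (B : set (L.-tuple R)),
          [/\ (s < t)%N, measurable B & H = perf X n s @^-1` B],
        exists s (B : set (L.-tuple R)),
          [/\ (s < t)%N, measurable B & H = ext X s @^-1` B] |
        (exists n k s, (s <= t)%N /\ H = [set w | renewal X n k w = s]) \/
        (exists n k s (B : set (A n)),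
          [/\ (s < t)%N, measurable B &
              H = [set w | renewal X n k w = s] `&` action X n k @^-1` B])] ] >>.

Section Runs.
Context {d : measure_display} {Omega : measurableType d}.
Variable P : probability Omega R.
Implicit Types X : evolution Omega.

(* Conditionally on the history before the (random) slot t_k^n and on the
   action, the k-th frame of system n has law [frame_law n k action]. *)
Definition renewal_property M X : Prop :=
  forall (n : 'I_N) (k t : nat) (H : set Omega) (B : set (A n))
      (C : set (frame R L)),
    history X t H -> measurable B -> measurable C ->
    let G := H `&` [set w | renewal X n k w = t] `&` action X n k @^-1` B in
    (P (G `&` frame_of X n k @^-1` C)
       = \int[P]_(w in G) frame_law M n k (action X n k w) C)%E.

(* Since [history X t] contains ext[0], ..., ext[t-1], this makes the external
   process i.i.d. over slots. *)
Definition ext_iid M X : Prop :=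
  forall (t : nat) (C : set (L.-tuple R)), measurable C ->
    P (ext X t @^-1` C) = ext_law M C /\
    (forall H, history X t H ->
       P (H `&` ext X t @^-1` C) = (P H * P (ext X t @^-1` C))%E).

Record is_run M X : Prop := IsRun {
  run_renewal0 : forall n w, renewal X n 0 w = 0%N;
  run_renewal_lt : forall n k w, (renewal X n k w < renewal X n k.+1 w)%N;
  run_renewal_meas : forall n k, measurable_fun setT (renewal X n k);
  run_action_meas : forall n k, measurable_fun setT (action X n k);
  run_penalty_meas : forall n t, measurable_fun setT (penalty X n t);
  run_perf_meas : forall n t, measurable_fun setT (perf X n t);
  run_ext_meas : forall t, measurable_fun setT (ext X t);
  run_renewal_property : renewal_property M X;
  run_ext_iid : ext_iid M X
}.

Definition avg_penalty X (T : nat) : \bar R :=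
  ((T%:R^-1)%:E * \sum_(0 <= t < T) \sum_(n < N) 'E_P[penalty X n t])%E.

Definition avg_perf X (l : 'I_L) (T : nat) : \bar R :=
  ((T%:R^-1)%:E *
     \sum_(0 <= t < T) \sum_(n < N) 'E_P[(fun w => tnth (perf X n t w) l)])%E.

Definition objective X : \bar R := limn_esup (avg_penalty X).

Definition satisfies_constraints M X : Prop :=
  forall l : 'I_L, (limn_esup (avg_perf X l) <= (ext_mean M l)%:E)%E.

Fixpoint queue X (t : nat) (w : Omega) (l : 'I_L) : R :=
  if t is s.+1 then
    Num.max (queue X s w l + \sum_(n < N) tnth (perf X n s w) l
             - tnth (ext X s w) l) 0
  else 0.

Definition algorithm_cost M (V : R) (q : 'I_L -> R) (n : 'I_N) (a : A n) : R :=
  V * fhat M a + \sum_(l < L) q l * ghat M a 0 l.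

Definition follows_algorithm M (V : R) X : Prop :=
  forall (n : 'I_N) (k : nat) (w : Omega) (a : A n),
    algorithm_cost M V (queue X (renewal X n k w) w) (action X n k w)
      <= algorithm_cost M V (queue X (renewal X n k w) w) a.

End Runs.

(* Decision sequences range over all probability spaces, so that arbitrary
   auxiliary randomization of the actions is allowed. *)
Definition attainable M : set (\bar R) :=
  [set v | exists (d : measure_display) (Omega : measurableType d)
             (P : probability Omega R) (X : evolution Omega),
     [/\ is_run P M X, satisfies_constraints P M X & v = objective P X]].

Definition feasible M : Prop := attainable M !=set0.

Definition fstar M : \bar R := ereal_inf (attainable M).

Definition lagrange_assumption M : Prop :=
  exists2 gamma : 'I_L -> R, (forall l, 0 <= gamma l) &
    forall p : 'I_N -> R * 'rV[R]_L, (forall n, region_P M n (p n)) ->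
      (fstar M + (\sum_(l < L) gamma l * ext_mean M l)%:E
        <= (\sum_(n < N) (p n).1
            + \sum_(l < L) gamma l * \sum_(n < N) (p n).2 0 l)%:E)%E.

End Model.

Arguments renewal_model R {N} L {dA} A.
Arguments evolution R {N} L {dA} A Omega.

(* Main.v *)
(** The renewal property says that, weighted by any quantity known at the start
    of a frame, the sum over the whole frame of [y[t] - fhat] (or of
    [z_l[t] - ghat_l]) has mean zero.  Cutting the frames at time [T] costs only
    the residual length of the last frame, whose mean is bounded by the residual
    lifetime assumption.  With constant weights this shows that a lower bound
    [m <= V fhat + <q, ghat>], valid for all actions, passes to the time averages
    of every run, hence [m <= V f_* + <q, d>] as soon as [V, q >= 0].

    For the algorithm the weights are [V] and the queues at the start of the
    current frame.  Minimality of the chosen action and the Lipschitz continuity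
    of the queues make the current cost, up to a multiple of the age of the
    frame, a lower bound valid for all actions at the present queues [Q[t]]; by
    the previous paragraph it is at most [V f_* + <Q[t], d>].  As [d[t]] is
    independent of [Q[t]], the drift-plus-penalty inequality becomes
    [E |Q[T]|^2 + 2 V E(sum y) <= 2 V f_* T + C (V + T)], which bounds the
    penalty.  The Lagrange multipliers bound [f_* T - E(sum y)] by
    [<gamma, E Q[T]> + C], hence [E |Q[T]|^2 <= 2 V <gamma, E Q[T]> + C (V + T)],
    and [E Q_l[T] = O(eps T)] follows for [V = 1/eps] and [T >= 1/eps^2]. *)

Require Import Defs.
From HB Require Import structures.
From mathcomp Require Import all_boot all_order all_algebra.
From mathcomp Require Import all_classical all_reals all_analysis.
From mathcomp Require Import measurable_realfun zify ring lra.

Set Implicit Arguments.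
Unset Strict Implicit.
Unset Printing Implicit Defensive.

Import Order.TTheory GRing.Theory Num.Theory.
Import numFieldNormedType.Exports.

Local Open Scope classical_set_scope.
Local Open Scope ring_scope.

(** * Disintegration along a kernel *)

(** The renewal property is given only for rectangles (history event, action set, frame set) at a
    deterministic slot, whereas the weights are functions of the whole past and frames start at
    random slots. Two devices bridge this gap. Uniqueness of measures extends rectangles to
    measurable functions of past, action and frame; the past is the sample point itself, read in the
    sigma-algebra of the history. And sums over slots are regrouped by frame number [k] and start
    slot [u], with the indicator of [renewal X n k w = u], so that conditioning always happens at a
    fixed slot. The comparison with [f_*] needs no conditioning on the queues: an inequality valid
    for all constant nonnegative weights is applied at each sample point to the values that the
    queues take there. The error [C (V + T)] has its shape because the queues are only known to grow
    at most linearly: the weights up to [T] are at most [V + K1 * T], and this factor multiplies the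
    bounded mean overshoot of the last frame. Frame ages and squared increments add terms linear in
    [T]. *)

Lemma ge0_integral_mrestr d (T : measurableType d) (R : realType)
    (mu : {measure set T -> \bar R}) (D : set T) (mD : measurable D)
    (f : T -> \bar R) :
  (forall x, 0 <= f x)%E -> measurable_fun [set: T] f ->
  (\int[(mrestr mu mD : {measure set T -> \bar R})]_x f x
     = \int[mu]_(x in D) f x)%E.
Proof.
move=> f0 mf.
rewrite (@ge0_negligible_integral _ _ _ _ setT (~` D))//=.
- rewrite setTD setCK.
  apply: eq_measure_integral => A mA AD.
  by rewrite /mrestr; congr (mu _); exact: setIidl.
- exact: measurableC.
- by rewrite /mrestr setICl.
Qed.

Section disintegration.
Context {R : realType} {d0 d1 d2 d3 : measure_display}.
Context {T : measurableType d0} {Y1 : measurableType d1}.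
Context {Y2 : measurableType d2} {Z : measurableType d3}.
Variables (P : probability T R) (G : set T) (mG : measurable G).
Variables (phi1 : T -> Y1) (phi2 : T -> Y2) (psi : T -> Z).
Hypothesis mphi1 : measurable_fun setT phi1.
Hypothesis mphi2 : measurable_fun setT phi2.
Hypothesis mpsi : measurable_fun setT psi.
Variable kappa : R.-pker Y2 ~> Z.

Let phi (w : T) := (phi1 w, phi2 w).

Let mphi : measurable_fun setT phi.
Proof. exact/measurable_fun_pair. Qed.

Let joint (w : T) := (phi w, psi w).

Let mjoint : measurable_fun setT joint.
Proof. exact/measurable_fun_pair. Qed.

Let base (_ : unit) : {measure set T -> \bar R} := mrestr P mG.

Let base_meas U : measurable U -> measurable_fun setT (base ^~ U).
Proof. by move=> mU; exact: measurable_cst. Qed.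

HB.instance Definition _ := isKernel.Build _ _ _ _ _ base base_meas.

Let base_uub : measure_fam_uub base.
Proof.
exists 2 => -[]; rewrite /base /= /mrestr setTI.
by rewrite (le_lt_trans (probability_le1 _ mG))// lte_fin ltr1n.
Qed.

HB.instance Definition _ := Kernel_isFinite.Build _ _ _ _ _ base base_uub.

Let msection (w : T) : measurable_fun setT (fun z : Z => (phi w, z)).
Proof. exact/measurable_fun_pair. Qed.

Let lifted (x : T) : {measure set Z -> \bar R} := kappa (phi2 x).

Let lifted_meas U : measurable U -> measurable_fun setT (lifted ^~ U).
Proof.
by move=> mU; exact: (measurableT_comp (measurable_kernel kappa _ mU) mphi2).
Qed.

HB.instance Definition _ := isKernel.Build _ _ _ _ _ lifted lifted_meas.

Let lifted_prob x : lifted x setT = 1%E.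
Proof. exact: prob_kernel. Qed.

HB.instance Definition _ := Kernel_isProbability.Build _ _ _ _ _ lifted lifted_prob.

(** Law of [((phi1 w, phi2 w), z)] when [w] is frozen and [z] is drawn from the kernel. The idle
    [unit] factor is the source of [base]: a kernel composed after [base] must live on source times
    intermediate space. *)
Let fiber (x : unit * T) : {measure set ((Y1 * Y2) * Z) -> \bar R} :=
  measure_function_pushforward__canonical__measure_function_Measure
    (lifted x.2) (msection x.2).

Let fiber_meas U : measurable U -> measurable_fun setT (fiber ^~ U).
Proof.
move=> mU; pose V : set (T * Z) := (fun wz => (phi wz.1, wz.2)) @^-1` U.
have mV : measurable V.
  rewrite -[V]setTI; apply: measurable_fun_pair => //=.
  exact: measurableT_comp mphi measurable_fst.
have -> : fiber ^~ U = (fun w => lifted w (xsection V w)) \o snd.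
  apply/funext => -[u w]; rewrite /fiber /= /pushforward; congr (lifted _ _).
  by apply/seteqP; split=> z /=; rewrite /xsection /= inE.
apply: measurableT_comp; last exact: measurable_snd.
by apply: measurable_fun_xsection_finite_kernel; rewrite inE.
Qed.

HB.instance Definition _ := isKernel.Build _ _ _ _ _ fiber fiber_meas.

Let fiber_prob x : fiber x setT = 1%E.
Proof. by rewrite /fiber /= /pushforward preimage_setT lifted_prob. Qed.

HB.instance Definition _ := Kernel_isProbability.Build _ _ _ _ _ fiber fiber_prob.

Hypothesis rectangles : forall H B C,
  measurable H -> measurable B -> measurable C ->
  (P (G `&` phi1 @^-1` H `&` phi2 @^-1` B `&` psi @^-1` C)
     = \int[P]_(w in G `&` phi1 @^-1` H `&` phi2 @^-1` B) kappa (phi2 w) C)%E.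

Let boxes : set (set ((Y1 * Y2) * Z)) :=
  [set U | exists H B C, [/\ measurable H, measurable B, measurable C &
     U = (H `*` B) `*` C]].

Let measurable_boxes : @measurable _ ((Y1 * Y2) * Z)%type = <<s boxes >>.
Proof.
apply/seteqP; split; last first.
  apply: smallest_sub; first exact: sigma_algebra_measurable.
  move=> _ [H [B [C [mH mB mC ->]]]].
  by apply: measurableX => //; exact: measurableX.
rewrite measurable_prod_measurableType.
apply: smallest_sub; first exact: smallest_sigma_algebra.
move=> _ [E mE [C mC <-]].
have -> : E `*` C = (E `*` setT) `&` (setT `*` C).
  by rewrite -setXI setIT setTI.
apply: (@measurableI _ (g_sigma_algebraType boxes)); last first.
  apply: sub_sigma_algebra; exists setT, setT, C; split => //.
  by rewrite setXTT.
have : preimage_set_system setT (@fst (Y1 * Y2) Z) measurable (E `*` setT).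
  by exists E => //; rewrite setTI; apply/seteqP; split=> [[y z]|[y z]] //= [].
rewrite measurable_prod_measurableType.
have := @g_sigma_preimageE _ _ setT (@fst (Y1 * Y2) Z)
  [set A `*` B | A in (@measurable _ Y1) & B in (@measurable _ Y2)].
move=> <-; apply: sub_smallest2r; first exact: smallest_sigma_algebra.
move=> _ [_ [H mH [B mB <-]] <-].
exists H, B, setT; split=> //.
by rewrite setTI; apply/seteqP; split=> [[y z]|[y z]] //= [].
Qed.

Let boxesI : setI_closed boxes.
Proof.
move=> X X1 [H [B [C [mH mB mC ->]]]] [H' [B' [C' [mH' mB' mC' ->]]]].
exists (H `&` H'), (B `&` B'), (C `&` C').
by split; try exact: measurableI; rewrite -!setXI.
Qed.

Let joint_measure : {measure set ((Y1 * Y2) * Z) -> \bar R} :=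
  measure_function_pushforward__canonical__measure_function_Measure
    (base tt) mjoint.

(** Two finite measures that agree on the intersection-stable family [boxes] coincide, and on a box
    the equality is the hypothesis [rectangles]. *)
Let joint_law U : measurable U -> joint_measure U = mkcomp base fiber tt U.
Proof.
move=> mU.
apply: (measure_unique boxes (fun=> setT)) => //.
- by move=> _; exists setT, setT, setT; split=> //; rewrite !setXTT.
- by rewrite bigcup_const//; exists 0%N.
- move=> _ [H [B [C [mH mB mC ->]]]].
  have mGHB : measurable (G `&` phi1 @^-1` H `&` phi2 @^-1` B).
    apply: measurableI; first apply: measurableI => //.
    + by rewrite -[X in measurable X]setTI; exact: mphi1.
    + by rewrite -[X in measurable X]setTI; exact: mphi2.
  transitivity (P (G `&` phi1 @^-1` H `&` phi2 @^-1` B `&` psi @^-1` C)).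
    rewrite /joint_measure /= /pushforward /= /mrestr; congr (P _).
    by apply/seteqP; split=> w /=; rewrite /joint /phi /=; tauto.
  rewrite rectangles// /= /kcomp /=.
  rewrite [RHS]ge0_integral_mrestr//; last 2 first.
    by move=> w; exact: (measure_ge0 (fiber (tt, w))).
    have mU0 : measurable ((H `*` B) `*` C).
      by apply: measurableX => //; exact: measurableX.
    exact: (measurableT_comp (measurable_kernel fiber _ mU0) (pair1_measurable tt)).
  rewrite -setIA integral_mkcondr; apply: eq_integral => w _.
  rewrite patchE /= /pushforward; case: ifPn => [|/negP].
    rewrite inE => -[Hw Bw]; congr (lifted w _).
    by apply/seteqP; split=> z //= [].
  rewrite inE => nHB; rewrite [X in lifted w X](_ : _ = set0) ?measure0//.
  by apply/seteqP; split=> z //= -[] [Hw Bw] _; exact: nHB.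
- move=> _; rewrite [X in (X < _)%E](_ : _ = P G) /joint_measure /= /pushforward /= /mrestr.
  + by rewrite (le_lt_trans (probability_le1 _ mG))// ltry.
  + by rewrite preimage_setT setTI.
Qed.

Lemma ge0_disintegration (h : (Y1 * Y2) * Z -> \bar R) :
  (forall x, 0 <= h x)%E -> measurable_fun setT h ->
  (\int[P]_(w in G) h ((phi1 w, phi2 w), psi w)
   = \int[P]_(w in G) \int[kappa (phi2 w)]_z h ((phi1 w, phi2 w), z))%E.
Proof.
move=> h0 mh.
transitivity (\int[joint_measure]_x h x)%E.
  rewrite ge0_integral_pushforward//= preimage_setT ge0_integral_mrestr//.
  exact: measurableT_comp.
transitivity (\int[mkcomp base fiber tt]_x h x)%E.
  by apply: eq_measure_integral => U mU _; exact: joint_law.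
rewrite integral_kcomp//= /base ge0_integral_mrestr//=.
- apply: eq_integral => w _; rewrite ge0_integral_pushforward//.
- by move=> w; exact: integral_ge0.
- apply: (@measurableT_comp _ _ _ _ _ _
    (fun x => \int[fiber x]_z h z)%E) (pair1_measurable tt).
  exact: measurable_fun_integral_kernel (measurable_kernel fiber) _ h0 mh.
Qed.

Let measurable_mean_section (g : (Y1 * Y2) * Z -> \bar R) :
  (forall x, 0 <= g x)%E -> measurable_fun setT g ->
  measurable_fun G
    (fun w => \int[kappa (phi2 w)]_z g ((phi1 w, phi2 w), z))%E.
Proof.
move=> g0 mg; apply: measurable_funTS.
apply: (measurable_fun_integral_finite_kernel
  (fun wz : T * Z => g (phi wz.1, wz.2)) lifted) => //.
apply: (measurableT_comp mg); apply: measurable_fun_pair => //=.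
exact: measurableT_comp mphi measurable_fst.
Qed.

(** The one-sided form avoids joint integrability of [h]: it says that the integral of the positive
    part is at most that of the negative part, and [ge0_disintegration] applies to each part even
    when it is infinite. *)
Lemma disintegration_le0 (h : (Y1 * Y2) * Z -> R) :
  measurable_fun setT h ->
  (forall w, G w ->
     (kappa (phi2 w)).-integrable setT
       (fun z => (h ((phi1 w, phi2 w), z))%:E) /\
     (\int[kappa (phi2 w)]_z (h ((phi1 w, phi2 w), z))%:E <= 0)%E) ->
  (\int[P]_(w in G) (h ((phi1 w, phi2 w), psi w))%:E <= 0)%E.
Proof.
move=> mh hk.
have mhE : measurable_fun setT (EFin \o h) by exact/measurable_EFinP.
rewrite integralE sube_le0.
have -> : (fun w => (h (phi w, psi w))%:E)^\+%E
    = fun w => (EFin \o h)^\+%E (phi w, psi w).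
  by apply/funext => w; rewrite !funeposE.
have -> : (fun w => (h (phi w, psi w))%:E)^\-%E
    = fun w => (EFin \o h)^\-%E (phi w, psi w).
  by apply/funext => w; rewrite !funenegE.
rewrite (ge0_disintegration _ (measurable_funepos mhE))//.
rewrite (ge0_disintegration _ (measurable_funeneg mhE))//.
apply: ge0_le_integral => //.
- by move=> w _; exact: integral_ge0.
- by apply: measurable_mean_section => //; exact: measurable_funepos.
- by apply: measurable_mean_section => //; exact: measurable_funeneg.
- move=> w /hk [ih]; rewrite integralE sube_le0.
  have -> : (fun z => (h (phi w, z))%:E)^\+%E
      = fun z => (EFin \o h)^\+%E (phi w, z).
    by apply/funext => z; rewrite !funeposE.
  have -> : (fun z => (h (phi w, z))%:E)^\-%E
      = fun z => (EFin \o h)^\-%E (phi w, z).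
    by apply/funext => z; rewrite !funenegE.
  exact.
Qed.

End disintegration.

(** * Integrable random variables and their means *)

Section expectation_toolkit.
Context {R : realType} {d : measure_display} {T : measurableType d}.
Variable P : {measure set T -> \bar R}.

Definition summable_rv (f : T -> R) := P.-integrable setT (EFin \o f).

Implicit Types f g : T -> R.

Local Notation E f := (\int[P]_w f w)%R.

Lemma summable_rvD f g : summable_rv f -> summable_rv g ->
  summable_rv (fun w => f w + g w).
Proof. by move=> hf hg; exact: (integrableD measurableT hf hg). Qed.

Lemma summable_rvZ (k : R) f : summable_rv f -> summable_rv (fun w => k * f w).
Proof. by move=> hf; exact: (integrableZl measurableT k hf). Qed.

Lemma summable_rvB f g : summable_rv f -> summable_rv g ->
  summable_rv (fun w => f w - g w).
Proof. by move=> hf hg; exact: (integrableB measurableT hf hg). Qed.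

Lemma summable_rv_sum I (s : seq I) (Q : pred I) (F : I -> T -> R) :
  (forall i, Q i -> summable_rv (F i)) ->
  summable_rv (fun w => \sum_(i <- s | Q i) F i w).
Proof.
move=> hF; have := integrable_sum measurableT s hF.
by apply: eq_integrable => //= w _; rewrite sumEFin.
Qed.

Lemma measurable_summable_rv f : summable_rv f -> measurable_fun setT f.
Proof. by move=> /measurable_int /measurable_EFinP. Qed.

Lemma summable_rv_dominated f g : measurable_fun setT f -> summable_rv g ->
  {ae P, forall w, `|f w| <= g w} -> summable_rv f.
Proof.
move=> mf ig [N [mN N0 fg]].
apply/integrableP; split; first exact/measurable_EFinP.
have /integrableP [mg] := ig; apply: le_lt_trans.
apply: ae_ge0_le_integral => //.
- by apply: measurableT_comp => //; exact/measurable_EFinP.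
- exact: measurableT_comp.
- exists N; split => // w /= nfg; apply: fg => /= fg; apply: nfg => _.
  by rewrite lee_fin (le_trans fg)// ler_norm.
Qed.

Lemma meanD f g : summable_rv f -> summable_rv g ->
  E (fun w => f w + g w) = E f + E g.
Proof. by move=> hf hg; rewrite RintegralD. Qed.

Lemma meanB f g : summable_rv f -> summable_rv g ->
  E (fun w => f w - g w) = E f - E g.
Proof. by move=> hf hg; rewrite RintegralB. Qed.

Lemma meanZ (k : R) f : summable_rv f -> E (fun w => k * f w) = k * E f.
Proof. by move=> hf; rewrite RintegralZl. Qed.

Lemma mean_sum I (s : seq I) (Q : pred I) (F : I -> T -> R) :
  (forall i, Q i -> summable_rv (F i)) ->
  E (fun w => \sum_(i <- s | Q i) F i w) = \sum_(i <- s | Q i) E (F i).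
Proof.
move=> hF; elim: s => [|i s ih].
  rewrite big_nil; transitivity (E (fun=> 0)).
    by apply: eq_Rintegral => w _; rewrite big_nil.
  by rewrite /Rintegral integral0.
rewrite big_cons; case: ifPn => Qi; last first.
  by rewrite -ih; apply: eq_Rintegral => w _; rewrite big_cons (negPf Qi).
rewrite -ih -meanD; [|exact: hF|exact: summable_rv_sum].
by apply: eq_Rintegral => w _; rewrite big_cons Qi.
Qed.

Lemma mean_ge0_ae f : summable_rv f -> {ae P, forall w, 0 <= f w} -> 0 <= E f.
Proof.
move=> hf [N [mN N0 f0]].
have mf := measurable_summable_rv hf.
rewrite (_ : E f = E (fun w => `|f w|)).
  by apply: Rintegral_ge0 => w _.
congr fine; apply: ae_eq_integral => //.
- exact/measurable_EFinP.
- by apply/measurable_EFinP; exact: measurableT_comp.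
- exists N; split => // w /= nf; apply: f0 => /= f0; apply: nf => _.
  by rewrite ger0_norm.
Qed.

Lemma mean_le_ae f g : summable_rv f -> summable_rv g ->
  {ae P, forall w, f w <= g w} -> E f <= E g.
Proof.
move=> hf hg fg; rewrite -subr_ge0 -meanB//.
apply: mean_ge0_ae; first exact: summable_rvB.
by move: fg; apply: filterS => w; rewrite subr_ge0.
Qed.

Lemma mean_le f g : summable_rv f -> summable_rv g ->
  (forall w, f w <= g w) -> E f <= E g.
Proof. by move=> hf hg fg; apply: mean_le_ae => //; exact: aeW. Qed.

End expectation_toolkit.

Section probability_toolkit.
Context {R : realType} {d : measure_display} {T : measurableType d}.
Variable P : probability T R.
Implicit Types f g : T -> R.

Lemma summable_rv_cst (k : R) : summable_rv P (fun=> k).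
Proof. by apply: finite_measure_integrable_cst. Qed.

Lemma summable_rv_bounded (K : R) f : measurable_fun setT f ->
  {ae P, forall w, `|f w| <= K} -> summable_rv P f.
Proof.
by move=> mf; apply: summable_rv_dominated => //; exact: summable_rv_cst.
Qed.

Lemma mean_cst (k : R) : (\int[P]_w k)%R = k.
Proof.
rewrite (@Rintegral_cst _ _ _ P setT measurableT k).
have := congr1 (fun x => k * fine x) (probability_setT P).
by move=> /= h; exact: etrans h (mulr1 k).
Qed.

End probability_toolkit.

(** * Measurability of frames *)

(** Split over the countably many values of the index. This covers both evaluation at a random
    renewal slot and sums with a random number of terms. *)
Lemma measurable_fun_nat_index d d' (T : measurableType d)
    (Z : measurableType d') (c : T -> nat) (F : nat -> T -> Z) :
  measurable_fun setT c -> (forall s, measurable_fun setT (F s)) ->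
  measurable_fun setT (fun w => F (c w) w).
Proof.
move=> mc mF _ B mB; rewrite setTI.
have -> : (fun w => F (c w) w) @^-1` B
    = \bigcup_s (c @^-1` [set s] `&` F s @^-1` B).
  apply/seteqP; split=> [w /= Bw|w [s _ [/= ws ?]]] /=; last by rewrite ws.
  by exists (c w).
apply: bigcupT_measurable => s; apply: measurableI.
- by rewrite -[X in measurable X]setTI; exact: mc.
- by rewrite -[X in measurable X]setTI; exact: mF.
Qed.

Lemma measurable_nat_valued d (T : measurableType d) (c : T -> nat) :
  (forall s, measurable (c @^-1` [set s])) -> measurable_fun setT c.
Proof.
move=> mc _ B _; rewrite setTI.
have -> : c @^-1` B = \bigcup_(s in B) (c @^-1` [set s]).
  apply/seteqP; split=> [w /= Bw|w [s Bs /= ws]]; first by exists (c w).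
  by rewrite /preimage /= ws.
by apply: bigcup_measurable.
Qed.

Section frames.
Context {R : realType} {L : nat}.

Lemma measurable_frame_length : measurable_fun setT (@frame_length R L).
Proof.
apply: measurable_nat_valued => s.
by apply: sub_sigma_algebra; left; exists s.
Qed.

Lemma measurable_fun_frame_length (g : nat -> R) :
  measurable_fun setT (fun w : frame R L => g (frame_length w)).
Proof.
apply: (@measurable_fun_nat_index _ _ (frame R L) R (@frame_length R L)
  (fun s _ => g s)) => //.
exact: measurable_frame_length.
Qed.

Lemma measurable_frame_nth j :
  measurable_fun setT (fun w : frame R L => nth point w j : slot R L).
Proof.
move=> _ B mB; rewrite setTI.
by apply: sub_sigma_algebra; right; exists j, B.
Qed.

Definition frame_sum (v : slot R L -> R) (w : frame R L) : R :=
  \sum_(x <- w) v x.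

Lemma measurable_frame_sum (v : slot R L -> R) :
  measurable_fun setT v -> measurable_fun setT (frame_sum v).
Proof.
move=> mv.
have -> : frame_sum v = fun w => \sum_(0 <= j < frame_length w) v (nth point w j).
  by apply/funext => w; rewrite /frame_sum (big_nth point).
apply: (@measurable_fun_nat_index _ _ (frame R L) R (@frame_length R L)
  (fun s w => \sum_(0 <= j < s) v (nth point w j))).
  exact: measurable_frame_length.
move=> s; apply: measurable_sum => j.
exact: (measurableT_comp mv (measurable_frame_nth j)).
Qed.

Lemma frame_sum_cst (c : R) w :
  frame_sum (fun=> c) w = c * (frame_length w)%:R.
Proof.
by rewrite /frame_sum big_const_seq count_predT iter_addr_0 mulr_natr.
Qed.

(* [excess K] vanishes exactly on the slots (frames) whose entries are bounded
   by [K]; this makes the bad frames a measurable set. *)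
Definition excess (K : R) (x : slot R L) : R :=
  Num.max (`|x.1| - K) 0 + \sum_(l < L) Num.max (`|tnth x.2 l| - K) 0.

Lemma excess_ge0 K x : 0 <= excess K x.
Proof.
apply: addr_ge0; first by rewrite le_max lexx orbT.
by apply: sumr_ge0 => l _; rewrite le_max lexx orbT.
Qed.

Lemma excess_eq0 K x : (excess K x == 0) =
  (`|x.1| <= K) && [forall l, `|tnth x.2 l| <= K].
Proof.
rewrite paddr_eq0; last 2 first.
- by rewrite le_max lexx orbT.
- by apply: sumr_ge0 => l _; rewrite le_max lexx orbT.
have max0 (y : R) : (Num.max (y - K) 0 == 0) = (y <= K).
  by rewrite -subr_le0; apply/eqP/idP => [/max_idPr|/max_idPr].
rewrite max0 psumr_eq0; last by move=> l _; rewrite le_max lexx orbT.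
congr (_ && _); apply/allP/forallP => [h l|h l _].
- by have := h l; rewrite mem_index_enum /= max0; apply.
- by rewrite /= max0.
Qed.

Lemma measurable_excess K : measurable_fun setT (excess K).
Proof.
apply: measurable_funD.
  apply: measurable_maxr => //; apply: measurable_funB => //.
  exact: measurableT_comp.
apply: measurable_sum => l; apply: measurable_maxr => //.
apply: measurable_funB => //; apply: measurableT_comp => //.
exact: (measurableT_comp (measurable_tnth l) measurable_snd).
Qed.

Definition good_frame (K : R) (w : frame R L) := frame_sum (excess K) w == 0.

Lemma good_frameP K w : good_frame K w <->
  forall x, x \in (w : seq (slot R L)) ->
    `|x.1| <= K /\ forall l, `|tnth x.2 l| <= K.
Proof.
rewrite /good_frame psumr_eq0; last by move=> x _; exact: excess_ge0.
split=> [/allP h x xw|h].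
  have := h x xw; rewrite /= excess_eq0 => /andP[-> /forallP ?]; split=> //.
apply/allP => x xw; rewrite /= excess_eq0; have [-> hl] := h x xw.
exact/forallP.
Qed.

Lemma measurable_bad_frames K :
  measurable [set w : frame R L | ~~ good_frame K w].
Proof.
have -> : [set w : frame R L | ~~ good_frame K w]
    = frame_sum (excess K) @^-1` (~` [set 0]).
  by apply/seteqP; split=> w /=; rewrite /good_frame => /eqP.
rewrite -[X in measurable X]setTI.
apply: (measurable_frame_sum (measurable_excess K)) => //.
by apply: measurableC; exact: measurable_set1.
Qed.

Lemma frame_sum_bound K (v : slot R L -> R) w :
  (forall x, x \in (w : seq (slot R L)) -> `|v x| <= K) ->
  `|frame_sum v w| <= K * (frame_length w)%:R.
Proof.
move=> vK; rewrite -frame_sum_cst /frame_sum.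
apply: le_trans (ler_norm_sum _ _ _) _.
by rewrite big_seq [leRHS]big_seq; apply: ler_sum.
Qed.

End frames.

(** * Moments of the frame laws *)

Section kernel_moments.
Context {R : realType} {N L : nat} {dA : 'I_N -> measure_display}.
Context {A : forall n : 'I_N, measurableType (dA n)}.
Variable M : renewal_model R L A.

(* [None] stands for the penalty, [Some l] for the l-th performance. *)
Definition component (i : option 'I_L) (x : slot R L) : R :=
  if i is Some l then tnth x.2 l else x.1.

Definition mean_component (i : option 'I_L) (n : 'I_N) (a : A n) : R :=
  if i is Some l then mean_perf M a 0 l else mean_penalty M a.

Definition ratio (i : option 'I_L) (n : 'I_N) (a : A n) : R :=
  mean_component i a / mean_length M a.

Lemma ratio_Some l n (a : A n) : ratio (Some l) a = ghat M a 0 l.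
Proof. by rewrite /ratio /ghat mxE mulrC. Qed.

(** One constant [K] serves penalties, performances and the external process. The residual bound is
    multiplied out, so that it also holds when the conditioning event has probability zero. *)
Record uniform_bounds (K B : R) : Prop := UniformBounds {
  bound_ge0 : 0 <= K;
  frames_good : forall (n : 'I_N) (k : nat) (a : A n),
    frame_law M n k a [set w : frame R L | ~~ good_frame K w] = 0%E;
  ext_good : {ae ext_law M, forall x, forall l, `|tnth x l| <= K};
  residual_ge0 : 0 <= B;
  residual_moment : forall (n : 'I_N) (k : nat) (a : A n) (s : nat),
    (\int[frame_law M n k a]_(w in [set w | (s <= frame_length w)%N])
       (((frame_length w)%:R - s%:R) ^+ 2)%:E
     <= B%:E * frame_law M n k a [set w | (s <= frame_length w)%N])%E
}.

Lemma measurable_length_ge s :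
  measurable [set w : frame R L | (s <= frame_length w)%N].
Proof.
rewrite -[X in measurable X]setTI.
exact: (@measurable_frame_length R L measurableT [set m | (s <= m)%N]).
Qed.

Lemma uniform_bounds_exist : standing_assumptions M ->
  exists K B, uniform_bounds K B.
Proof.
move=> [spec [ymax [zmax [dmax [bnd ebnd]]]] [B B1 res] _].
pose K := `|ymax| + `|zmax| + `|dmax|.
have yK : ymax <= K by rewrite /K; have := ler_norm ymax; have := normr_ge0 zmax;
  have := normr_ge0 dmax; lra.
have zK : zmax <= K by rewrite /K; have := ler_norm zmax; have := normr_ge0 ymax;
  have := normr_ge0 dmax; lra.
have dK : dmax <= K by rewrite /K; have := ler_norm dmax; have := normr_ge0 zmax;
  have := normr_ge0 ymax; lra.
exists K, B; split.
- by rewrite /K !addr_ge0.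
- move=> n k a; have [N0 [mN0 N00 sub]] := bnd n k a.
  apply: (subset_measure0 (measurable_bad_frames K) mN0 _ N00).
  move=> w /= bad; apply: sub => /= h; move/negP: bad; apply.
  apply/good_frameP => x xw; have [h1 h2] := h x xw.
  by split=> [|l]; [exact: le_trans yK|exact: le_trans zK].
- by move: ebnd; apply: filterS => x h l; exact: le_trans (h l) dK.
- exact: le_trans B1.
- move=> n k a s; set E := [set w | (s <= frame_length w)%N].
  have mE : measurable E by exact: measurable_length_ge.
  have [E0|E0] := eqVneq (frame_law M n k a E) 0%E.
    rewrite E0 mule0 null_set_integral//.
    apply: measurable_funTS; apply/measurable_EFinP.
    exact: (measurable_fun_frame_length (fun m => (m%:R - s%:R) ^+ 2)).
  have Epos : (0 < frame_law M n k a E)%E by rewrite lt0e E0 measure_ge0.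
  have := res n k a s Epos; rewrite -/E /event_mean.
  have Efin : frame_law M n k a E \is a fin_num.
    by apply: finite_kernel_measure.
  rewrite lee_pdivrMl ?fineK//; last by rewrite fine_gt0// Epos ltey_eq Efin.
  by rewrite muleC.
Qed.

Section bounds.
Variables (K B : R).
Hypothesis spec : frame_law_spec M.
Hypothesis bnd : uniform_bounds K B.

Section law.
Variables (n : 'I_N) (k : nat) (a : A n).
Local Notation mu := (frame_law M n k a).
Local Notation len := (fun w : frame R L => (frame_length w)%:R : R).

Lemma good_frames_ae : {ae mu, forall w, good_frame K w}.
Proof.
exists [set w : frame R L | ~~ good_frame K w].
by split=> [||w /= /negP //]; [exact: measurable_bad_frames|exact: (frames_good bnd)].
Qed.

Lemma mean_lengthE : (\int[mu]_w (len w)%:E = (mean_length M a)%:E)%E.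
Proof. by have [_ -> _ _] := spec k a. Qed.

Lemma mean_componentE i :
  (\int[mu]_w (frame_sum (component i) w)%:E = (mean_component i a)%:E)%E.
Proof. by have [_ _ Ey Ez] := spec k a; case: i => [l|]; [exact: Ez|exact: Ey]. Qed.

Lemma summable_length : summable_rv mu len.
Proof.
apply/integrableP; split.
  by apply/measurable_EFinP; exact: measurable_fun_frame_length.
under eq_integral do rewrite /= ger0_norm//.
by rewrite mean_lengthE ltry.
Qed.

Lemma frame_length_pos_ae : {ae mu, forall w, 1 <= len w}.
Proof.
have [E0 _ _ _] := spec k a.
exists [set w | frame_length w = 0%N]; split => //.
  rewrite -[X in measurable X]setTI.
  exact: (@measurable_frame_length R L measurableT [set 0%N]).
by move=> w /= /negP; rewrite ler1n -leqNgt leqn0 => /eqP.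
Qed.

Lemma mean_length_ge1 : 1 <= mean_length M a.
Proof.
rewrite -lee_fin -mean_lengthE.
have <- : (\int[mu]_w 1%:E = 1%:E)%E.
  by rewrite integral_cst// prob_kernel mule1.
apply: ae_ge0_le_integral => //.
  by apply/measurable_EFinP; exact: measurable_fun_frame_length.
by move: frame_length_pos_ae; apply: filterS => w h _; rewrite lee_fin.
Qed.

Lemma mean_length_gt0 : 0 < mean_length M a.
Proof. exact: lt_le_trans mean_length_ge1. Qed.

Lemma measurable_component i : measurable_fun setT (component i).
Proof.
case: i => [l|] /=; last exact: measurable_fst.
exact: (measurableT_comp (measurable_tnth l) measurable_snd).
Qed.

Lemma component_bound i w : good_frame K w ->
  `|frame_sum (component i) w| <= K * len w.
Proof.
move=> /good_frameP gw; apply: frame_sum_bound => x /gw [h1 h2].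
by case: i => [l|] /=.
Qed.

Lemma summable_component i : summable_rv mu (frame_sum (component i)).
Proof.
apply: (summable_rv_dominated (g := fun w => K * len w)).
- by apply: measurable_frame_sum; exact: measurable_component.
- by apply: summable_rvZ; exact: summable_length.
- by move: good_frames_ae; apply: filterS => w; exact: component_bound.
Qed.

Lemma mean_component_bound i : `|mean_component i a| <= K * mean_length M a.
Proof.
rewrite -lee_fin EFinM -mean_lengthE.
rewrite -ge0_integralZl//; last 2 first.
- by apply/measurable_EFinP; exact: measurable_fun_frame_length.
- by rewrite lee_fin (bound_ge0 bnd).
have := mean_componentE i.
have mc : measurable_fun setT (EFin \o frame_sum (component i)).
  apply/measurable_EFinP; apply: measurable_frame_sum.
  exact: measurable_component.
have := le_abse_integral mu measurableT mc => + Ei.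
rewrite Ei /= => /le_trans; apply.
apply: ae_ge0_le_integral => //.
- apply/measurable_EFinP; apply: measurableT_comp => //.
  exact/measurable_EFinP.
- by move=> w _; rewrite mule_ge0// lee_fin ?(bound_ge0 bnd).
- apply: emeasurable_funM => //; apply/measurable_EFinP.
  exact: measurable_fun_frame_length.
- by move: good_frames_ae; apply: filterS => w gw _; rewrite lee_fin component_bound.
Qed.

Lemma ratio_bound i : `|ratio i a| <= K.
Proof.
rewrite /ratio normrM normfV (gtr0_norm mean_length_gt0).
by rewrite ler_pdivrMr ?mean_length_gt0// mean_component_bound.
Qed.

Lemma summable_centered i q :
  summable_rv mu (fun w => q * (frame_sum (component i) w - ratio i a * len w)).
Proof.
apply: summable_rvZ; apply: summable_rvB; first exact: summable_component.
by apply: summable_rvZ; exact: summable_length.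
Qed.

(** The ratio of the two means is the only slope for which this holds; the factor [q] stands for a
    weight already known at the start of the frame. *)
Lemma mean_centered i q :
  (\int[mu]_w (q * (frame_sum (component i) w - ratio i a * len w))%:E = 0)%E.
Proof.
have sc := summable_component i; have sl := summable_length.
under eq_integral do rewrite EFinM.
rewrite integralZl//; last exact: summable_rvB sc (summable_rvZ _ sl).
rewrite (_ : (\int[mu]_w _)%E = 0%E) ?mule0//.
under eq_integral do rewrite EFinB.
rewrite integralB_EFin//; last exact: (summable_rvZ _ sl).
rewrite mean_componentE.
under eq_integral do rewrite EFinM.
rewrite integralZl// mean_lengthE -EFinM -EFinB /ratio.
by rewrite divfK ?subrr// gt_eqF// mean_length_gt0.
Qed.

Lemma length_square_moment : (\int[mu]_w ((len w) ^+ 2)%:E <= B%:E)%E.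
Proof.
have := residual_moment bnd k a 0.
have -> : [set w : frame R L | (0 <= frame_length w)%N] = setT.
  by apply/seteqP; split.
rewrite prob_kernel mule1; apply: le_trans.
rewrite le_eqVlt; apply/orP; left; apply/eqP.
by apply: eq_integral => w _; rewrite subr0.
Qed.

(** A natural number is at most its square, and the truncated difference [frame_length w - s]
    vanishes off the event on the right. *)
Lemma residual_mean s :
  (\int[mu]_w ((frame_length w - s)%:R)%:E
    <= B%:E * mu [set w | (s <= frame_length w)%N])%E.
Proof.
apply: le_trans (residual_moment bnd k a s).
rewrite [leRHS]integral_mkcond; apply: ge0_le_integral => //.
- by apply/measurable_EFinP; exact: (measurable_fun_frame_length (fun m => (m - s)%:R)).
- apply/measurable_restrict => //; first exact: measurable_length_ge.
  rewrite setTI; apply: measurable_funTS; apply/measurable_EFinP.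
  exact: (measurable_fun_frame_length (fun m => (m%:R - s%:R) ^+ 2)).
- move=> w _; rewrite patchE; case: ifPn => [|/negP]; rewrite inE /=.
    move=> sl; rewrite lee_fin -natrB// -natrX ler_nat.
    by case: (_ - s)%N => [//|m]; rewrite expnS leq_pmulr// expn_gt0.
  by move=> /negP; rewrite -ltnNge => /ltnW /eqP ->.
Qed.

End law.

(** The model gives the mean length as a bare function of the action; its measurability comes from
    being an integral against a kernel. Frame number 0 will do, since the mean is the same for all
    frames. *)
Lemma measurable_mean_length n : measurable_fun setT (@mean_length _ _ _ _ _ M n).
Proof.
apply/measurable_EFinP.
have -> : EFin \o @mean_length _ _ _ _ _ M n
    = fun a => (\int[frame_law M n 0%N a]_w ((frame_length w)%:R)%:E)%E.
  by apply/funext => a; rewrite mean_lengthE.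
apply: measurable_fun_integral_kernel => //.
- by move=> U mU; exact: measurable_kernel.
- by apply/measurable_EFinP; exact: measurable_fun_frame_length.
Qed.

Lemma measurable_ratio i n : measurable_fun setT (@ratio i n).
Proof.
have mc : measurable_fun setT (@mean_component i n).
  apply/measurable_EFinP.
  have mf : measurable_fun setT (EFin \o frame_sum (component i)).
    apply/measurable_EFinP; apply: measurable_frame_sum.
    exact: measurable_component.
  have -> : EFin \o @mean_component i n = fun a =>
      ((\int[frame_law M n 0%N a]_w (EFin \o frame_sum (component i))^\+ w)
       - (\int[frame_law M n 0%N a]_w (EFin \o frame_sum (component i))^\- w))%E.
    by apply/funext => a; rewrite -integralE mean_componentE.
  apply: emeasurable_funB; apply: measurable_fun_integral_kernel => //.
  - by move=> U mU; exact: measurable_kernel.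
  - exact: measurable_funepos.
  - by move=> U mU; exact: measurable_kernel.
  - exact: measurable_funeneg.
(* For a positive length the inverse is the power with exponent -1, a measurable function. *)
have -> : @ratio i n = fun a => mean_component i a * (mean_length M a) `^ (-1).
  by apply/funext => a; rewrite powR_inv1// ltW// mean_length_gt0.
apply: measurable_funM => //.
apply: (@measurableT_comp _ _ _ _ _ _ (fun x : R => x `^ (-1)) _
  (@mean_length _ _ _ _ _ M n)).
- exact: measurable_powR.
- exact: measurable_mean_length.
Qed.

End bounds.

End kernel_moments.

(** * Histories and frames of a run *)

Lemma integral_indicator d (T : measurableType d) (R : realType)
    (mu : {measure set T -> \bar R}) (b : pred T) (f : T -> R) :
  (\int[mu]_(w in [set w | b w]) (f w)%:E
    = \int[mu]_w ((b w)%:R * f w)%:E)%E.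
Proof.
rewrite integral_mkcond; apply: eq_integral => w _.
rewrite patchE; case: ifPn; rewrite ?inE /=; first by move=> ->; rewrite mul1r.
by rewrite notin_setE /= => /negP/negPf ->; rewrite mul0r.
Qed.

Section runs.
Context {R : realType} {N L : nat} {dA : 'I_N -> measure_display}.
Context {A : forall n : 'I_N, measurableType (dA n)}.
Context {d : measure_display} {Omega : measurableType d}.
Variables (M : renewal_model R L A) (P : probability Omega R).
Variable X : evolution R L A Omega.
Hypothesis run : is_run P M X.

Local Notation hist t := (g_sigma_algebraType (history X t)).
Local Notation r n k w := (renewal X n k w).

Lemma historyE t : @measurable _ (hist t) = history X t.
Proof. by rewrite /measurable /=; apply: sigma_algebra_id; exact: smallest_sigma_algebra. Qed.

Lemma measurable_renewal_eq n k s : measurable [set w | r n k w = s].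
Proof.
suff : measurable (setT `&` renewal X n k @^-1` [set s]) by rewrite setTI.
by apply: run_renewal_meas run _ _ _ _ _.
Qed.

Lemma history_measurable t H : history X t H -> measurable H.
Proof.
apply: smallest_sub => //; first exact: sigma_algebra_measurable.
move=> {}H [[n [s [B [_ mB ->]]]]|[n [s [B [_ mB ->]]]]|[s [B [_ mB ->]]]|].
- by rewrite -[X in measurable X]setTI; exact: (run_penalty_meas run).
- by rewrite -[X in measurable X]setTI; exact: (run_perf_meas run).
- by rewrite -[X in measurable X]setTI; exact: (run_ext_meas run).
- case=> [[n [k [s [_ ->]]]]|[n [k [s [B [_ mB ->]]]]]].
    exact: measurable_renewal_eq.
  apply: measurableI; first exact: measurable_renewal_eq.
  by rewrite -[X in measurable X]setTI; exact: (run_action_meas run).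
Qed.

(** The identity into [hist t] is the variable [phi1] of the disintegration: it carries the entire
    past of slot [t], so any history-measurable weight can be used as a function of it. *)
Lemma measurable_to_history t : measurable_fun setT (id : Omega -> hist t).
Proof.
by move=> _ B; rewrite historyE setTI => /history_measurable.
Qed.

Lemma history_perf n s t : (s < t)%N ->
  measurable_fun setT (perf X n s : hist t -> L.-tuple R).
Proof.
move=> st _ B mB; rewrite setTI historyE.
by apply: sub_sigma_algebra; constructor 2; exists n, s, B.
Qed.

Lemma history_ext s t : (s < t)%N ->
  measurable_fun setT (ext X s : hist t -> L.-tuple R).
Proof.
move=> st _ B mB; rewrite setTI historyE.
by apply: sub_sigma_algebra; constructor 3; exists s, B.
Qed.

Lemma history_queue l s t : (s <= t)%N ->
  measurable_fun setT ((fun w => queue X s w l) : hist t -> R).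
Proof.
elim: s => [|s ih] st /=; first exact: measurable_cst.
apply: measurable_maxr => //; apply: measurable_funB.
  apply: measurable_funD; first exact: ih (ltnW st).
  apply: measurable_sum => n.
  exact: (measurableT_comp (measurable_tnth l) (history_perf n st)).
exact: (measurableT_comp (measurable_tnth l) (history_ext st)).
Qed.

Definition slot_at (n : 'I_N) (t : nat) (w : Omega) : slot R L :=
  (penalty X n t w, perf X n t w).

Lemma measurable_slot_at n t : measurable_fun setT (slot_at n t).
Proof.
by apply: measurable_fun_pair; [exact: run_penalty_meas run _ _|
  exact: run_perf_meas run _ _].
Qed.

Definition len (n : 'I_N) (k : nat) (w : Omega) : nat := (r n k.+1 w - r n k w)%N.

Lemma frame_length_frame_of n k w : frame_length (frame_of X n k w) = len n k w.
Proof. by rewrite /frame_length /frame_of size_map size_iota. Qed.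

Lemma measurable_len n k : measurable_fun setT (len n k).
Proof.
apply: (@measurable_fun_nat_index _ _ Omega nat (renewal X n k)
  (fun s w => (r n k.+1 w - s)%N)); first exact: (run_renewal_meas run).
move=> s; apply: (@measurable_fun_nat_index _ _ Omega nat (renewal X n k.+1)
  (fun m _ => (m - s)%N)) => //; exact: (run_renewal_meas run).
Qed.

Lemma frame_sum_frame_of n k w v : frame_sum v (frame_of X n k w)
  = \sum_(r n k w <= t < r n k.+1 w) v (slot_at n t w).
Proof. by rewrite /frame_sum /frame_of big_map. Qed.

Lemma nth_frame_of n k w j : nth point (frame_of X n k w) j =
  if (j < len n k w)%N then slot_at n (r n k w + j) w else point.
Proof.
rewrite /frame_of; case: ltnP => jl.
  by rewrite (nth_map 0%N) ?size_iota// nth_iota.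
by rewrite nth_default// size_map size_iota.
Qed.

Lemma measurable_frame_of n k : measurable_fun setT (frame_of X n k).
Proof.
apply: (@measurability _ _ Omega (frame R L) setT (frame_of X n k)
  (@frame_cylinders R L) erefl).
move=> _ [C [[s ->]|[j [B mB ->]]] <-].
  have -> : setT `&` frame_of X n k @^-1` [set w | size w = s]
      = len n k @^-1` [set s].
    rewrite setTI; apply/funext => w; apply/propext.
    by rewrite /preimage /= -frame_length_frame_of.
  by rewrite -[X in measurable X]setTI; exact: measurable_len.
(* The entry [j] as a function of the sample point: frame length and start slot are both random, and
   past the end of the frame the value is the default [point]. *)
pose g w := if (j < len n k w)%N then slot_at n (r n k w + j) w else point.
have mg : measurable_fun setT g.
  apply: (@measurable_fun_nat_index _ _ Omega (slot R L) (len n k)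
    (fun m w => if (j < m)%N then slot_at n (r n k w + j) w else point)).
    exact: measurable_len.
  move=> m /=; case: (j < m)%N; last exact: measurable_cst.
  apply: (@measurable_fun_nat_index _ _ Omega (slot R L) (renewal X n k)
    (fun u w => slot_at n (u + j) w)); first exact: (run_renewal_meas run).
  by move=> u; exact: measurable_slot_at.
have -> : setT `&` frame_of X n k @^-1` [set w | B (nth point w j)] = setT `&` g @^-1` B.
  by congr (_ `&` _); apply/seteqP; split=> w /=; rewrite nth_frame_of.
exact: mg.
Qed.

Variables K B : R.
Hypothesis spec : frame_law_spec M.
Hypothesis bnd : uniform_bounds M K B.

Let frame_rectangles n k u (G := [set w | r n k w = u]) :
  forall (H : set (hist u)) (D : set (A n)) (C : set (frame R L)),
  measurable H -> measurable D -> measurable C ->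
  (P (G `&` (id : Omega -> hist u) @^-1` H `&` action X n k @^-1` D
        `&` frame_of X n k @^-1` C)
     = \int[P]_(w in G `&` (id : Omega -> hist u) @^-1` H
          `&` action X n k @^-1` D) frame_law M n k (action X n k w) C)%E.
Proof.
move=> H D C; rewrite historyE => mH mD mC.
have := @run_renewal_property _ _ _ _ _ _ _ _ _ _ run n k u H D C mH mD mC.
by rewrite (setIC H).
Qed.

Lemma frame_ge0_mean n k u (g : frame R L -> \bar R) :
  (forall x, 0 <= g x)%E -> measurable_fun setT g ->
  (\int[P]_(w in [set w | r n k w = u]) g (frame_of X n k w)
   = \int[P]_(w in [set w | r n k w = u])
       \int[frame_law M n k (action X n k w)]_x g x)%E.
Proof.
move=> g0 mg.
apply: (@ge0_disintegration R _ _ _ _ Omega (hist u) (A n) (frame R L) P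
  [set w | r n k w = u] _ id (action X n k) (frame_of X n k) _ _ _
  (frame_law M n k) (@frame_rectangles n k u) (fun y => g y.2)) => //.
- exact: measurable_renewal_eq.
- exact: measurable_to_history.
- exact: (run_action_meas run).
- exact: measurable_frame_of.
- exact: (measurableT_comp mg measurable_snd).
Qed.

Lemma frame_weighted_le0 n k u (h : (hist u * A n) * frame R L -> R) :
  measurable_fun setT h ->
  (forall w, r n k w = u ->
     summable_rv (frame_law M n k (action X n k w))
       (fun x => h ((w, action X n k w), x)) /\
     (\int[frame_law M n k (action X n k w)]_x
        (h ((w, action X n k w), x))%:E <= 0)%E) ->
  (\int[P]_(w in [set w | r n k w = u])
     (h ((w, action X n k w), frame_of X n k w))%:E <= 0)%E.
Proof.
move=> mh hk.
apply: (@disintegration_le0 R _ _ _ _ Omega (hist u) (A n) (frame R L) P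
  [set w | r n k w = u] _ id (action X n k) (frame_of X n k) _ _ _
  (frame_law M n k) (@frame_rectangles n k u) h) => //.
- exact: measurable_renewal_eq.
- exact: measurable_to_history.
- exact: (run_action_meas run).
- exact: measurable_frame_of.
Qed.

End runs.

(** * Decomposition of a time interval into frames *)

Section renewal_index.
Variable rho : nat -> nat.
Hypothesis rho0 : rho 0 = 0%N.
Hypothesis rho_lt : forall k, (rho k < rho k.+1)%N.

(** Number of the frame that contains slot [t]. Since renewals are strictly increasing, it advances
    by at most one per slot. *)
Fixpoint frame_index (t : nat) : nat :=
  if t is s.+1 then
    if rho (frame_index s).+1 == s.+1 then (frame_index s).+1 else frame_index s
  else 0%N.

Lemma frame_indexP t : (rho (frame_index t) <= t < rho (frame_index t).+1)%N.
Proof.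
elim: t => [|t /andP[lo hi]] /=; first by rewrite rho0 /= (leq_ltn_trans _ (rho_lt 0)).
case: ifPn => [/eqP rt|rt]; first by rewrite rt leqnn -rt rho_lt.
by rewrite (leq_trans lo)//= ltn_neqAle eq_sym rt.
Qed.

Lemma rho_mono : {mono rho : j k / (j <= k)%N}.
Proof. by apply: leq_mono; apply: homo_ltn => //; exact: ltn_trans. Qed.

Lemma leq_rho k : (k <= rho k)%N.
Proof. by elim: k => // k ih; exact: leq_ltn_trans ih (rho_lt k). Qed.

Lemma frame_index_le t : (frame_index t <= t)%N.
Proof. by have /andP[+ _] := frame_indexP t; exact/leq_trans/leq_rho. Qed.

Lemma frame_index_unique k t :
  (rho k <= t < rho k.+1)%N = (k == frame_index t).
Proof.
have /andP[lo hi] := frame_indexP t.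
apply/idP/eqP => [/andP[lo' hi']|->]; last by rewrite lo hi.
apply/eqP; rewrite eqn_leq; apply/andP; split.
  by rewrite -ltnS -(leqW_mono rho_mono); exact: leq_ltn_trans hi.
by rewrite -ltnS -(leqW_mono rho_mono); exact: leq_ltn_trans hi'.
Qed.

(** The random start [rho k] is traded for a sum over deterministic slots [u], because the renewal
    property is stated at a fixed slot. Frames with [k >= T] do not meet the interval, as
    [k <= rho k]. *)
Lemma sum_frames (V : pzRingType) T (phi : nat -> nat -> V) :
  \sum_(t < T) phi (frame_index t) t
  = \sum_(k < T) \sum_(u < T) (rho k == u)%:R *
      \sum_(t < T) ((u <= t < rho k.+1)%N)%:R * phi k t.
Proof.
transitivity (\sum_(k < T) \sum_(t < T)
    ((rho k <= t < rho k.+1)%N)%:R * phi k t).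
  rewrite exchange_big /=; apply: eq_bigr => t _.
  have kT : (frame_index t < T)%N by exact: leq_ltn_trans (frame_index_le t) _.
  rewrite (bigD1 (Ordinal kT))//= frame_index_unique eqxx mul1r big1 ?addr0//.
  move=> k; rewrite -val_eqE /= frame_index_unique => /negPf ->.
  by rewrite mul0r.
apply: eq_bigr => k _; have [kT|kT] := ltnP (rho k) T.
  rewrite [RHS](bigD1 (Ordinal kT))//= eqxx mul1r [X in _ = _ + X]big1 ?addr0//.
  by move=> u; rewrite -val_eqE /= eq_sym => /negPf ->; rewrite mul0r.
rewrite !big1//.
  move=> u _; rewrite (_ : (rho k == u) = false) ?mul0r//.
  by apply/eqP => E; move: kT; rewrite E leqNgt ltn_ord.
move=> t _; rewrite (_ : (rho k <= t)%N = false) ?mul0r//.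
by rewrite leqNgt (leq_trans _ kT).
Qed.

(** The condition says that the frame starts before [T] and ends at [T] or later. Its indicator is
    the difference of the indicators of [rho k < T] and [rho k.+1 < T], which telescopes. *)
Lemma sum_last_frame (F : numDomainType) T :
  \sum_(k < T) \sum_(u < T) (rho k == u)%:R * ((T - u <= rho k.+1 - rho k)%N)%:R
  <= 1 :> F.
Proof.
have -> : \sum_(k < T) \sum_(u < T)
    (rho k == u)%:R * ((T - u <= rho k.+1 - rho k)%N)%:R
    = \sum_(0 <= k < T) (((rho k < T)%N)%:R - ((rho k.+1 < T)%N)%:R) :> F.
  rewrite big_mkord; apply: eq_bigr => k _.
  have [kT|kT] := ltnP (rho k) T.
    rewrite (bigD1 (Ordinal kT))//= eqxx mul1r big1 ?addr0; last first.
      by move=> u; rewrite -val_eqE /= eq_sym => /negPf ->; rewrite mul0r.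
    rewrite leq_subLR subnKC ?(ltnW (rho_lt k))//.
    by case: ltnP => _; rewrite ?subr0 ?subrr.
  rewrite (ltnNge (rho k.+1)) (leq_trans kT (ltnW (rho_lt k))) subrr.
  rewrite big1// => u _; rewrite (_ : (rho k == u) = false) ?mul0r//.
  by apply/eqP => E; move: kT; rewrite E leqNgt ltn_ord.
rewrite sumrB.
have -> : \sum_(0 <= k < T) ((rho k < T)%N)%:R
    - \sum_(0 <= k < T) ((rho k.+1 < T)%N)%:R
    = ((rho 0 < T)%N)%:R - ((rho T < T)%N)%:R :> F.
  (* Only the number of summands varies in the induction; the threshold [T] inside the indicators
     stays fixed. *)
  elim: {1 3 6}T => [|m ih]; first by rewrite !big_nil !subrr.
  by rewrite !big_nat_recr//= opprD addrACA ih addrA subrK.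
rewrite rho0 (ltnNge (rho T)) leq_rho subr0.
by rewrite lern1 leq_b1.
Qed.

End renewal_index.

(** A frame cut at [T] is the whole frame minus its overshoot, the second sum being empty if
    [v <= T]. The whole frame will have mean zero and the overshoot a bounded mean. *)
Lemma sum_window (V : pzRingType) (f : nat -> V) (u v T : nat) :
  (u <= T)%N -> (u <= v)%N ->
  \sum_(t < T) ((u <= t < v)%N)%:R * f t
  = \sum_(u <= t < v) f t - \sum_(T <= t < v) f t.
Proof.
move=> uT uv; rewrite -(big_mkord xpredT (fun t => ((u <= t < v)%N)%:R * f t)).
rewrite (big_cat_nat (leq0n u) uT) /= big_nat_cond big1 ?add0r; last first.
  by move=> t /andP[/andP[_ tu] _]; rewrite leqNgt tu mul0r.
have [Tv|vT] := leqP T v.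
  rewrite [X in X - _](big_cat_nat uT Tv) /= addrK.
  by apply: eq_big_nat => t /andP[-> tT]; rewrite (leq_trans tT) // mul1r.
rewrite [X in _ - X]big_geq ?(ltnW vT)// subr0 (big_cat_nat uv (ltnW vT))//=.
rewrite [X in _ + X]big_nat_cond [X in _ + X]big1 ?addr0; last first.
  by move=> t /andP[/andP[vt _] _]; rewrite (ltnNge t) vt andbF mul0r.
by apply: eq_big_nat => t /andP[-> ->]; rewrite mul1r.
Qed.

Lemma ae_ord (R : realType) (d : measure_display) (T : measurableType d)
    (mu : {measure set T -> \bar R}) (n : nat) (Q : 'I_n -> T -> Prop) :
  (forall i, {ae mu, forall w, Q i w}) -> {ae mu, forall w, forall i, Q i w}.
Proof.
move=> h.
have : {ae mu, forall w, forall m, forall mn : (m < n)%N, Q (Ordinal mn) w}.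
  apply: ae_foralln => m; have [mn|mn] := pselect (m < n)%N; last first.
    by apply: aeW => w mn'; case: (mn mn').
  have := h (Ordinal mn); apply: filterS => w Qw mn'.
  by rewrite (bool_irrelevance mn' mn).
apply: filterS => w Qw [m mn]; exact: Qw.
Qed.

Lemma ge0_summable_le (R : realType) (d : measure_display) (T : measurableType d)
    (mu : {measure set T -> \bar R}) (f : T -> R) (c : R) :
  measurable_fun setT f -> (forall w, 0 <= f w) ->
  (\int[mu]_w (f w)%:E <= c%:E)%E ->
  summable_rv mu f /\ (\int[mu]_w f w)%R <= c.
Proof.
move=> mf f0 fc.
have sf : summable_rv mu f.
  apply/integrableP; split; first exact/measurable_EFinP.
  under eq_integral do rewrite /= ger0_norm//.
  exact: le_lt_trans fc (ltry _).
split => //; rewrite -lee_fin /Rintegral fineK//.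
exact: integrable_fin_num.
Qed.

(** * Almost sure bounds and length moments along a run *)

Section moments.
Context {R : realType} {N L : nat} {dA : 'I_N -> measure_display}.
Context {A : forall n : 'I_N, measurableType (dA n)}.
Context {d : measure_display} {Omega : measurableType d}.
Variables (M : renewal_model R L A) (P : probability Omega R).
Variable X : evolution R L A Omega.
Hypothesis run : is_run P M X.
Variables K B : R.
Hypothesis spec : frame_law_spec M.
Hypothesis bnd : uniform_bounds M K B.

Local Notation hist t := (g_sigma_algebraType (history X t)).
Local Notation r n k w := (renewal X n k w).
Local Notation E f := (\int[P]_w f w)%R.

Definition good_run (w : Omega) : Prop :=
  (forall n k, good_frame K (frame_of X n k w)) /\
  (forall t l, `|tnth (ext X t w) l| <= K).

(** A bad frame starting at slot [u] has as its probability an integral of kernel masses that are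
    all zero; countably many pairs of frame number and start slot remain to be united. *)
Lemma good_run_ae : {ae P, forall w, good_run w}.
Proof.
have ae_frames : {ae P, forall w, forall n k, good_frame K (frame_of X n k w)}.
  apply: ae_ord => n; apply: ae_foralln => k.
  pose F u := [set w | r n k w = u] `&`
    frame_of X n k @^-1` [set x | ~~ good_frame K x].
  have negF u : P.-negligible (F u).
    apply/negligibleP.
      apply: measurableI; first exact: (measurable_renewal_eq run).
      rewrite -[X in measurable X]setTI; apply: (measurable_frame_of run) => //.
      exact: measurable_bad_frames.
    have := @run_renewal_property _ _ _ _ _ _ _ _ _ _ run n k u setT setT
      [set x | ~~ good_frame K x].
    rewrite preimage_setT setIT setTI => e; refine (etrans (e _ _ _) _) => //.
    - by rewrite -historyE; exact: measurableT.
    - exact: measurable_bad_frames.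
    - by rewrite integral0_eq// => w _; exact: (frames_good bnd).
  have := negligible_bigcup negF; apply: negligibleS => w /= /negP bad.
  by exists (r n k w).
have ae_ext : {ae P, forall w, forall t l, `|tnth (ext X t w) l| <= K}.
  apply: ae_foralln => t; have [C [mC C0 sub]] := ext_good bnd.
  exists (ext X t @^-1` C); split.
  - by rewrite -[X in measurable X]setTI; apply: (run_ext_meas run).
  - have [e _] := run_ext_iid run t mC; exact: etrans e C0.
  - by move=> w /= bad; apply: sub.
apply: filterS2 ae_frames ae_ext => w h1 h2; by split.
Qed.

(** Every slot lies in some frame, so the bounds on frames reach all slots. *)
Lemma good_component i n t w : good_run w -> `|component i (slot_at X n t w)| <= K.
Proof.
move=> [gf _].
pose k := frame_index (fun k => r n k w) t.
have ri := frame_indexP (run_renewal0 run n w)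
  (fun k => run_renewal_lt run n k w) t.
have tk : slot_at X n t w \in (frame_of X n k w : seq _).
  apply/mapP; exists t => //; rewrite mem_iota.
  by rewrite subnKC// ltnW// (run_renewal_lt run).
have [h1 h2] := (good_frameP _ _).1 (gf n k) _ tk.
by case: i => [l|] /=; [exact: h2|exact: h1].
Qed.

Lemma measurable_component_at i n t :
  measurable_fun setT (fun w => component i (slot_at X n t w)).
Proof.
exact: (measurableT_comp (measurable_component i) (measurable_slot_at run n t)).
Qed.

Lemma measurable_nat_fun (c : Omega -> nat) (g : nat -> R) :
  measurable_fun setT c -> measurable_fun setT (fun w => g (c w)).
Proof.
move=> mc; exact: (@measurable_fun_nat_index _ _ Omega R c (fun s _ => g s)).
Qed.

Lemma mean_indicator (b : pred Omega) : measurable [set w | b w] ->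
  ((E (fun w => (b w)%:R))%:E = P [set w | b w])%E.
Proof.
move=> mb; rewrite /Rintegral.
have -> : (\int[P]_w ((b w)%:R)%:E = P [set w | b w])%E.
  have := integral_indicator P b (fun=> 1).
  under [RHS]eq_integral do rewrite mulr1.
  by move=> <-; rewrite integral_cst// mul1e.
by rewrite fineK// fin_num_measure.
Qed.

Lemma renewal_eqE n k u : [set w | r n k w = u] = [set w | r n k w == u].
Proof. by apply/seteqP; split=> w /= /eqP. Qed.

(** Common form of the next two lemmas: a bound [beta] on a moment under the frame law, for each
    action, is integrated over the event that frame [k] starts at [u]. It is constant for the second
    moment and proportional to a survival probability for the residual length. *)
Lemma frame_moment n k u (g : nat -> R) (beta : A n -> \bar R) (c : R) :
  (forall m, 0 <= g m) -> (forall a, 0 <= beta a)%E ->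
  measurable_fun setT beta ->
  (forall a, \int[frame_law M n k a]_x (g (frame_length x))%:E <= beta a)%E ->
  (\int[P]_(w in [set w | r n k w = u]) beta (action X n k w) = c%:E)%E ->
  summable_rv P (fun w => (r n k w == u)%:R * g (len X n k w)) /\
  E (fun w => (r n k w == u)%:R * g (len X n k w)) <= c.
Proof.
move=> g0 beta0 mbeta gbeta betac.
apply: ge0_summable_le.
- apply: measurable_funM.
    by apply: (measurable_nat_fun (fun m => (m == u)%:R)); exact: (run_renewal_meas run).
  by apply: measurable_nat_fun; exact: (measurable_len run).
- by move=> w; rewrite mulr_ge0.
rewrite -(integral_indicator P (fun w => r n k w == u)) -renewal_eqE.
have mg : measurable_fun setT (fun x : frame R L => (g (frame_length x))%:E).
  by apply/measurable_EFinP; exact: measurable_fun_frame_length.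
have -> : (\int[P]_(w in [set w | r n k w = u]) (g (len X n k w))%:E
    = \int[P]_(w in [set w | r n k w = u])
        (g (frame_length (frame_of X n k w)))%:E)%E.
  by apply: eq_integral => w _; rewrite frame_length_frame_of.
rewrite (frame_ge0_mean run n k u (g := fun x => (g (frame_length x))%:E))//;
  last by move=> x; rewrite lee_fin.
rewrite -betac; apply: ge0_le_integral => //.
- exact: (measurable_renewal_eq run).
- by move=> w _; apply: integral_ge0 => x _; rewrite lee_fin.
- apply: measurable_funTS.
  apply: (@measurableT_comp _ _ _ _ _ _
    (fun a => \int[frame_law M n k a]_x (g (frame_length x))%:E)%E _
    (action X n k)); last exact: (run_action_meas run).
  apply: (measurable_fun_integral_kernel (measurable_kernel (frame_law M n k))) => //.
  by move=> x; rewrite lee_fin.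
- apply: measurable_funTS.
  apply: (@measurableT_comp _ _ _ _ _ _ beta _ (action X n k)).
    exact: mbeta.
  exact: run_action_meas run n k.
Qed.

Lemma length_moment n k u :
  summable_rv P (fun w => (r n k w == u)%:R * (len X n k w)%:R ^+ 2) /\
  E (fun w => (r n k w == u)%:R * (len X n k w)%:R ^+ 2)
    <= B * E (fun w => (r n k w == u)%:R).
Proof.
apply: (@frame_moment n k u (fun m => m%:R ^+ 2) (fun=> B%:E)) => //.
- by move=> a; rewrite lee_fin (residual_ge0 bnd).
- by move=> a; exact: (length_square_moment bnd).
- have mG := measurable_renewal_eq run n k u.
  by rewrite integral_cst// EFinM mean_indicator -?renewal_eqE.
Qed.

(** Keeping the survival indicator on the right is essential. For [s = T - u] the event is that the
    frame reaches [T], which at most one frame does, so that the bounds summed over all frames stay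
    below [B]. *)
Lemma residual_bound n k u s :
  summable_rv P (fun w => (r n k w == u)%:R * (len X n k w - s)%:R) /\
  E (fun w => (r n k w == u)%:R * (len X n k w - s)%:R)
    <= B * E (fun w => (r n k w == u)%:R * ((s <= len X n k w)%N)%:R).
Proof.
pose S := [set x : frame R L | (s <= frame_length x)%N].
have mS : measurable S by exact: measurable_length_ge.
have mG := measurable_renewal_eq run n k u.
apply: (@frame_moment n k u (fun m => (m - s)%:R)
  (fun a => B%:E * frame_law M n k a S)%E) => //.
- by move=> a; rewrite mule_ge0// lee_fin (residual_ge0 bnd).
- by apply: emeasurable_funM => //; exact: measurable_kernel.
- by move=> a; exact: (residual_mean bnd).
- rewrite ge0_integralZl//; last 2 first.
  + apply: measurable_funTS.
    apply: (@measurableT_comp _ _ _ _ _ _ (frame_law M n k ^~ S) _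
      (action X n k)); first exact: measurable_kernel.
    exact: run_action_meas run n k.
  + by rewrite lee_fin (residual_ge0 bnd).
  have := @run_renewal_property _ _ _ _ _ _ _ _ _ _ run n k u setT setT S.
  rewrite preimage_setT setIT setTI => e; rewrite -(e _ _ mS)//; last first.
    by rewrite -historyE; exact: measurableT.
  rewrite EFinM; congr (_ * _)%E.
  under eq_Rintegral do rewrite -natrM mulnb.
  have Eset : [set w | r n k w = u] `&` frame_of X n k @^-1` S
      = [set w | (r n k w == u) && (s <= len X n k w)%N].
    apply/seteqP; split=> w; rewrite /S /= frame_length_frame_of.
      by move=> [-> ->]; rewrite eqxx.
    by move=> /andP[/eqP -> ->].
  rewrite mean_indicator -Eset//.
  apply: measurableI => //; rewrite -[X in measurable X]setTI.
  exact: (measurable_frame_of run).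
Qed.

End moments.

(** * Balance of deviations over frames *)

Lemma mean_double_sum (R : realType) (d : measure_display)
    (Omega : measurableType d) (P : {measure set Omega -> \bar R}) (T : nat)
    (F : nat -> nat -> Omega -> R) :
  (forall k u, (u < T)%N -> summable_rv P (F k u)) ->
  summable_rv P (fun w => \sum_(k < T) \sum_(u < T) F k u w) /\
  (\int[P]_w (\sum_(k < T) \sum_(u < T) F k u w)
    = \sum_(k < T) \sum_(u < T) \int[P]_w F k u w)%R.
Proof.
move=> sF.
have s1 (k : 'I_T) : summable_rv P (fun w => \sum_(u < T) F k u w).
  by apply: summable_rv_sum => u _; exact: sF.
split; first by apply: summable_rv_sum => k _; exact: s1.
rewrite (@mean_sum _ _ _ P _ _ _ (fun (k : 'I_T) w => \sum_(u < T) F k u w))//.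
apply: eq_bigr => k _.
rewrite (@mean_sum _ _ _ P _ _ _ (fun (u : 'I_T) w => F k u w))// => u _; exact: sF.
Qed.

Section balance.
Context {R : realType} {N L : nat} {dA : 'I_N -> measure_display}.
Context {A : forall n : 'I_N, measurableType (dA n)}.
Context {d : measure_display} {Omega : measurableType d}.
Variables (M : renewal_model R L A) (P : probability Omega R).
Variable X : evolution R L A Omega.
Hypothesis run : is_run P M X.
Variables K B : R.
Hypothesis spec : frame_law_spec M.
Hypothesis bnd : uniform_bounds M K B.

Local Notation hist t := (g_sigma_algebraType (history X t)).
Local Notation r n k w := (renewal X n k w).
Local Notation E f := (\int[P]_w f w)%R.

Definition current (n : 'I_N) (t : nat) (w : Omega) : nat :=
  frame_index (fun k => r n k w) t.

Definition start (n : 'I_N) (t : nat) (w : Omega) : nat := r n (current n t w) w.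

Lemma currentP n t w :
  (start n t w <= t < r n (current n t w).+1 w)%N.
Proof.
exact: (frame_indexP (run_renewal0 run n w) (fun k => run_renewal_lt run n k w)).
Qed.

Definition deviation i n k t (w : Omega) : R :=
  component i (slot_at X n t w) - ratio M i (action X n k w).

Let K0 : 0 <= K := bound_ge0 bnd.

Lemma deviation_bound i n k t w : good_run X K w ->
  `|deviation i n k t w| <= 2 * K.
Proof.
move=> gw; apply: le_trans (ler_normB _ _) _.
have h1 := good_component run i n t gw.
have h2 := ratio_bound spec bnd k (action X n k w) i.
by lra.
Qed.

Lemma measurable_ratio_action i n k :
  measurable_fun setT (fun w => ratio M i (action X n k w)).
Proof.
apply: (@measurableT_comp _ _ _ _ _ _ (@ratio _ _ _ _ _ M i n) _ (action X n k)).
  exact: (measurable_ratio spec).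
exact: run_action_meas run n k.
Qed.

Lemma measurable_deviation i n k t : measurable_fun setT (deviation i n k t).
Proof.
apply: measurable_funB; first exact: (measurable_component_at run).
exact: measurable_ratio_action.
Qed.

Lemma frame_deviation i n k w :
  \sum_(r n k w <= t < r n k.+1 w) deviation i n k t w
  = frame_sum (component i) (frame_of X n k w)
    - ratio M i (action X n k w) * (frame_length (frame_of X n k w))%:R.
Proof.
rewrite sumrB frame_sum_frame_of; congr (_ - _).
by rewrite frame_length_frame_of /len big_const_nat iter_addr_0 mulr_natr.
Qed.

Lemma measurable_indicator n k u :
  measurable_fun setT (fun w => (r n k w == u)%:R : R).
Proof.
by apply: (measurable_nat_fun (fun m => (m == u)%:R)); exact: (run_renewal_meas run).
Qed.

Lemma summable_length_at n k u :
  summable_rv P (fun w => (r n k w == u)%:R * (len X n k w)%:R).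
Proof.
have [s2 _] := length_moment run bnd n k u.
apply: summable_rv_dominated s2 _.
  apply: measurable_funM; first exact: measurable_indicator.
  by apply: measurable_nat_fun; exact: (measurable_len run).
apply: aeW => w; rewrite ger0_norm ?mulr_ge0//.
by apply: ler_wpM2l => //; rewrite -natrX ler_nat; case: (len _ _ _ _) => // m;
  rewrite expnS leq_pmulr// expn_gt0.
Qed.

Lemma measurable_window n k u t :
  measurable_fun setT (fun w => ((u <= t < r n k.+1 w)%N)%:R : R).
Proof.
apply: (measurable_nat_fun (fun m => ((u <= t < m)%N)%:R)).
exact: (run_renewal_meas run).
Qed.

Section weighted.
Variables (i : option 'I_L) (n : 'I_N) (T : nat) (q : nat -> Omega -> R) (K1 : R).
Hypothesis K10 : 0 <= K1.
Hypothesis qhist : forall u, (u < T)%N -> measurable_fun setT (q u : hist u -> R).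
Hypothesis qbound : forall u w, (u < T)%N -> good_run X K w -> `|q u w| <= K1.

Let mq u : (u < T)%N -> measurable_fun setT (q u : Omega -> R).
Proof.
move=> uT _ D mD; apply: (history_measurable run (t := u)).
by rewrite -historyE; exact: (qhist uT).
Qed.

Definition weighted_deviation (w : Omega) : R :=
  \sum_(t < T) q (start n t w) w * deviation i n (current n t w) t w.

(** Once the start slot is fixed to [u], the weight [q u] is measurable for the history at [u]. The
    cut sum in [term] need not have mean zero; only the complete frame in [whole] does. *)
Let term k u (w : Omega) : R :=
  (r n k w == u)%:R * (q u w *
    \sum_(t < T) ((u <= t < r n k.+1 w)%N)%:R * deviation i n k t w).

Let whole k u (w : Omega) : R :=
  (r n k w == u)%:R * (q u w *
    \sum_(r n k w <= t < r n k.+1 w) deviation i n k t w).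

Let weighted_deviationE w :
  weighted_deviation w = \sum_(k < T) \sum_(u < T) term k u w.
Proof.
rewrite /weighted_deviation (sum_frames (run_renewal0 run n w)
  (fun k => run_renewal_lt run n k w) T
  (fun k t => q (r n k w) w * deviation i n k t w)).
apply: eq_bigr => k _; apply: eq_bigr => u _; rewrite /term.
have [ru|] := eqVneq (r n k w) u; last by rewrite !mul0r.
rewrite !mul1r mulr_sumr; apply: eq_bigr => t _.
by rewrite ru mulrCA.
Qed.

Let term_measurable k u : (u < T)%N -> measurable_fun setT (term k u).
Proof.
move=> uT; apply: measurable_funM; first exact: measurable_indicator.
apply: measurable_funM; first exact: mq.
apply: measurable_sum => t; apply: measurable_funM; last exact: measurable_deviation.
exact: measurable_window.
Qed.

Let term_summable k u : (u < T)%N -> summable_rv P (term k u).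
Proof.
move=> uT; apply: (@summable_rv_bounded _ _ _ P (K1 * (T%:R * (2 * K)))).
  exact: term_measurable.
have := good_run_ae run bnd; apply: filterS => w gw.
rewrite /term !normrM; case: (_ == _); rewrite ?normr0 ?mul0r ?normr1 ?mul1r.
  apply: ler_pM => //; first exact: qbound.
  apply: le_trans (ler_norm_sum _ _ _) _.
  rewrite -[T in T%:R]card_ord mulr_natl -sumr_const ler_sum// => t _.
  rewrite normrM; have := deviation_bound i n k t gw.
  by case: (_ && _); rewrite ?normr0 ?normr1 ?mul0r ?mul1r ?mulr_ge0.
by rewrite !mulr_ge0.
Qed.

Lemma summable_weighted_deviation : summable_rv P weighted_deviation.
Proof.
rewrite (_ : weighted_deviation = fun w => \sum_(k < T) \sum_(u < T) term k u w).
  by have [] := mean_double_sum term_summable.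
by apply/funext => w; rewrite weighted_deviationE.
Qed.

Let whole_bound k u w : (u < T)%N -> good_run X K w ->
  `|whole k u w| <= (K1 * (2 * K)) * ((r n k w == u)%:R * (len X n k w)%:R).
Proof.
move=> uT gw; rewrite /whole normrM ger0_norm// mulrCA ler_wpM2l//.
rewrite normrM -mulrA ler_pM//; first exact: qbound.
apply: le_trans (ler_norm_sum _ _ _) _.
rewrite mulr_natr /len -iter_addr_0 -big_const_nat.
by apply: ler_sum => t _; exact: deviation_bound.
Qed.

Let whole_measurable k u : (u < T)%N -> measurable_fun setT (whole k u).
Proof.
move=> uT; apply: measurable_funM; first exact: measurable_indicator.
apply: measurable_funM; first exact: mq.
under eq_fun do rewrite frame_deviation.
apply: measurable_funB.
  apply: (@measurableT_comp _ _ _ _ _ _ (frame_sum (component i)) _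
    (frame_of X n k)); last exact: (measurable_frame_of run).
  by apply: measurable_frame_sum; exact: measurable_component.
apply: measurable_funM; first exact: measurable_ratio_action.
under eq_fun do rewrite frame_length_frame_of.
by apply: measurable_nat_fun; exact: (measurable_len run).
Qed.

Let whole_summable k u : (u < T)%N -> summable_rv P (whole k u).
Proof.
move=> uT; apply: (summable_rv_dominated (g := fun w =>
  (K1 * (2 * K)) * ((r n k w == u)%:R * (len X n k w)%:R))).
- exact: whole_measurable.
- by apply: summable_rvZ; exact: summable_length_at.
- have := good_run_ae run bnd; apply: filterS => w gw; exact: whole_bound.
Qed.

(* Given the history and the action, the deviations of a whole frame have
   conditional mean zero. *)
Let whole_mean k u : (u < T)%N -> E (whole k u) <= 0.
Proof.
move=> uT.
pose h (x : (hist u * A n) * frame R L) : R := q u x.1.1 *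
  (frame_sum (component i) x.2 - ratio M i x.1.2 * (frame_length x.2)%:R).
have mh : measurable_fun setT h.
  apply: measurable_funM.
    apply: (@measurableT_comp _ _ _ _ _ _ (q u : hist u -> R) _
      (fun x : (hist u * A n) * frame R L => x.1.1)); first exact: qhist.
    exact: (measurableT_comp measurable_fst measurable_fst).
  apply: measurable_funB.
    apply: (@measurableT_comp _ _ _ _ _ _ (frame_sum (component i)) _ snd) => //.
    by apply: measurable_frame_sum; exact: measurable_component.
  apply: measurable_funM.
    apply: (@measurableT_comp _ _ _ _ _ _ (@ratio _ _ _ _ _ M i n) _
      (fun x : (hist u * A n) * frame R L => x.1.2)).
      exact: (measurable_ratio spec).
    exact: (measurableT_comp measurable_snd measurable_fst).
  apply: (@measurableT_comp _ _ _ _ _ _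
    (fun x : frame R L => (frame_length x)%:R : R) _ snd) => //.
  exact: measurable_fun_frame_length.
have := frame_weighted_le0 run mh (n := n) (k := k) (u := u).
have -> : (\int[P]_(w in [set w | r n k w = u])
    (h ((w, action X n k w), frame_of X n k w))%:E
    = \int[P]_w (whole k u w)%:E)%E.
  rewrite renewal_eqE (integral_indicator P (fun w => r n k w == u)).
  apply: eq_integral => w _; rewrite /h /whole /= frame_deviation.
  by [].
move=> le0.
have : (\int[P]_w (whole k u w)%:E <= 0)%E.
  apply: le0 => w _; split.
  - exact: (summable_centered spec bnd k (action X n k w) i (q u w)).
  - by have := mean_centered spec bnd k (action X n k w) i (q u w); rewrite /h /= => ->.
rewrite /Rintegral; have := integrable_fin_num measurableT (whole_summable k uT).
by move=> /fineK <-; rewrite lee_fin.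
Qed.

(** The overshoot past [T] consists of [len X n k w - (T - u)] slots, each with weight at most [K1]
    and deviation at most [2 * K]. *)
Let term_whole k u w : (u < T)%N -> good_run X K w ->
  term k u w <= whole k u w
    + (K1 * (2 * K)) * ((r n k w == u)%:R * (len X n k w - (T - u))%:R).
Proof.
move=> uT gw; rewrite /term /whole.
have [ru|_] := eqVneq (r n k w) u; last by rewrite !mul0r mulr0 addr0.
have rlt := run_renewal_lt run n k w.
rewrite !mul1r (sum_window (fun t => deviation i n k t w)) ?(ltnW uT)//; last by rewrite -ru ltnW.
rewrite ru mulrBr lerD2l -mulrN.
apply: le_trans (ler_norm _) _; rewrite normrM normrN -mulrA.
apply: ler_pM => //; first exact: qbound.
apply: le_trans (ler_norm_sum _ _ _) _.
have -> : (len X n k w - (T - u) = r n k.+1 w - T)%N.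
  by rewrite /len ru; lia.
rewrite mulr_natr -iter_addr_0 -big_const_nat.
by apply: ler_sum => t _; exact: deviation_bound.
Qed.

(** Complete frames contribute nothing positive; the overshoots contribute at most [2 * K * K1 * B]
    times the expected number of frames that straddle [T], which is at most one. Hence there is no
    factor [T] beyond what [K1] may hide. *)
Lemma mean_weighted_deviation : E weighted_deviation <= 2 * K * K1 * B.
Proof.
have C0 : 0 <= K1 * (2 * K) by rewrite !mulr_ge0.
pose tl k u w : R := (r n k w == u)%:R * ((T - u <= len X n k w)%N)%:R.
have s_tl k u : summable_rv P (tl k u).
  apply: (@summable_rv_bounded _ _ _ P 1).
    apply: measurable_funM; first exact: measurable_indicator.
    apply: (measurable_nat_fun (fun m => ((T - u <= m)%N)%:R)).
    exact: (measurable_len run).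
  by apply: aeW => w; rewrite /tl; case: (_ == _); case: (_ <= _)%N;
    rewrite ?mulr0 ?mul0r ?mulr1 ?normr0 ?normr1.
have -> : E weighted_deviation = \sum_(k < T) \sum_(u < T) E (term k u).
  have [_ <-] := mean_double_sum term_summable.
  by apply: eq_Rintegral => w _; rewrite weighted_deviationE.
apply: (@le_trans _ _ (\sum_(k < T) \sum_(u < T)
    (K1 * (2 * K)) * (B * E (tl k u)))).
  apply: ler_sum => k _; apply: ler_sum => u _.
  have [s_res e_res] := residual_bound run bnd n k u (T - u).
  apply: le_trans (ler_wpM2l C0 e_res).
  rewrite -(meanZ _ s_res) -[leRHS]add0r.
  apply: le_trans (lerD (whole_mean k (ltn_ord u)) (lexx _)).
  rewrite -meanD; [|exact: whole_summable|exact: summable_rvZ].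
  apply: mean_le_ae; [exact: term_summable| |].
    by apply: summable_rvD; [exact: whole_summable|exact: summable_rvZ].
  by have := good_run_ae run bnd; apply: filterS => w gw; exact: term_whole.
under eq_bigr do (under eq_bigr do rewrite mulrA; rewrite -mulr_sumr).
rewrite -mulr_sumr.
have -> : 2 * K * K1 * B = (K1 * (2 * K) * B) * 1 by ring.
apply: ler_wpM2l; first by rewrite mulr_ge0// (residual_ge0 bnd).
have [s_sum <-] := mean_double_sum (T := T) (fun k u _ => s_tl k u).
rewrite -[leRHS](mean_cst P 1).
apply: mean_le => //; first exact: summable_rv_cst.
move=> w; exact: (sum_last_frame (run_renewal0 run n w)
  (fun k => run_renewal_lt run n k w)).
Qed.

End weighted.

Definition total_age (n : 'I_N) (T : nat) (w : Omega) : R :=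
  \sum_(t < T) (t - start n t w)%:R.

(** Within one frame the ages add up to at most the square of its length, with mean at most [B] per
    frame, and at most [T] frames start before [T]. *)
Lemma mean_total_age n T : summable_rv P (total_age n T) /\
  E (total_age n T) <= B * T%:R.
Proof.
pose sq k u w : R := (r n k w == u)%:R * (len X n k w)%:R ^+ 2.
pose age k u w : R := (r n k w == u)%:R *
  \sum_(t < T) ((u <= t < r n k.+1 w)%N)%:R * (t - u)%:R.
have ageE w : total_age n T w = \sum_(k < T) \sum_(u < T) age k u w.
  rewrite /total_age (sum_frames (run_renewal0 run n w)
    (fun k => run_renewal_lt run n k w) T (fun k t => (t - r n k w)%:R)).
  apply: eq_bigr => k _; apply: eq_bigr => u _; rewrite /age.
  by have [->|] := eqVneq (r n k w) u; last by rewrite !mul0r.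
have age_sq k u w : (u < T)%N -> age k u w <= sq k u w.
  move=> uT; rewrite /age /sq.
  have [ru|_] := eqVneq (r n k w) u; last by rewrite !mul0r.
  have rlt := run_renewal_lt run n k w.
  rewrite !mul1r; apply: (@le_trans _ _
    (\sum_(t < T) ((u <= t < r n k.+1 w)%N)%:R * (len X n k w)%:R)).
    apply: ler_sum => t _; case: andP => [[ut tr]|_]; last by rewrite !mul0r.
    by rewrite !mul1r ler_nat /len ru; lia.
  rewrite (sum_window (fun=> (len X n k w)%:R)) ?(ltnW uT)//; last by rewrite -ru ltnW.
  rewrite lerBlDr ler_wpDr//; first by rewrite sumr_ge0.
  by rewrite big_const_nat iter_addr_0 expr2 mulr_natr /len ru.
have s_sq k u : (u < T)%N -> summable_rv P (sq k u).
  by move=> _; have [] := length_moment run bnd n k u.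
have age0 k u w : 0 <= age k u w.
  by rewrite mulr_ge0// sumr_ge0// => t _; rewrite mulr_ge0.
have s_age k u : (u < T)%N -> summable_rv P (age k u).
  move=> uT; apply: summable_rv_dominated (s_sq k u uT) _.
    apply: measurable_funM; first exact: measurable_indicator.
    apply: measurable_sum => t; apply: measurable_funM => //.
    exact: measurable_window.
  by apply: aeW => w; rewrite ger0_norm// age_sq.
have [s_sum e_sum] := mean_double_sum s_age.
rewrite (_ : total_age n T = fun w => \sum_(k < T) \sum_(u < T) age k u w);
  last by apply/funext => w; rewrite ageE.
split => //; rewrite e_sum.
pose ind k u w : R := (r n k w == u)%:R.
have s_ind k u : (u < T)%N -> summable_rv P (ind k u).
  move=> _; apply: (@summable_rv_bounded _ _ _ P 1); first exact: measurable_indicator.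
  by apply: aeW => w; rewrite /ind; case: (_ == _); rewrite ?normr0 ?normr1.
apply: (@le_trans _ _ (\sum_(k < T) \sum_(u < T) (B * E (ind k u)))).
  apply: ler_sum => k _; apply: ler_sum => u _.
  have [_ e_sq] := length_moment run bnd n k u.
  apply: le_trans e_sq; apply: mean_le; [exact: s_age|exact: s_sq|].
  by move=> w; exact: age_sq.
under eq_bigr do rewrite -mulr_sumr; rewrite -mulr_sumr.
apply: ler_wpM2l; first exact: (residual_ge0 bnd).
have [s_sum2 <-] := mean_double_sum s_ind.
rewrite -[leRHS](mean_cst P T%:R).
apply: mean_le => //; first exact: summable_rv_cst.
move=> w; rewrite -[T in leRHS]card_ord -sumr_const; apply: ler_sum => k _.
have [kT|kT] := ltnP (r n k w) T.
  rewrite (bigD1 (Ordinal kT))//= /ind eqxx big1 ?addr0// => u.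
  by rewrite -val_eqE /= eq_sym => /negPf ->.
rewrite big1// => u _; rewrite /ind (_ : (_ == _) = false)//.
by apply/eqP => e; move: kT; rewrite e leqNgt ltn_ord.
Qed.

End balance.

(** * Time averages and the optimal value *)

Lemma limn_esup_lt_eventually (R : realType) (u : (\bar R)^nat) (c : \bar R) :
  (limn_esup u < c)%E -> exists m, forall n, (m <= n)%N -> (u n < c)%E.
Proof.
move=> /ereal_inf_lt[_ [V [m _ mV] <-] ltc].
exists m => n mn; apply: le_lt_trans ltc.
by apply: ereal_sup_ubound; exists n => //; exact: mV.
Qed.

Lemma limn_esup_ge (R : realType) (u : (\bar R)^nat) (a : \bar R) :
  (forall n, a <= u n)%E -> (a <= limn_esup u)%E.
Proof.
move=> au; apply: le_ereal_inf_tmp => _ [V [m _ mV] <-].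
apply: le_trans (au m) _; apply: ereal_sup_ubound; exists m => //.
by apply: mV => /=.
Qed.

Lemma limn_esup_le (R : realType) (u : (\bar R)^nat) (b : \bar R) :
  (forall n, u n <= b)%E -> (limn_esup u <= b)%E.
Proof.
move=> ub; apply: le_trans (_ : ereal_sup (u @` setT) <= b)%E.
  apply: ereal_inf_lbound; exists setT => //; exact: filterT.
by apply: ge_ereal_sup => _ [n _ <-].
Qed.

Lemma sum_option (V : nmodType) (L : nat) (F : option 'I_L -> V) :
  \sum_i F i = F None + \sum_(l < L) F (Some l).
Proof.
rewrite (bigD1 None)//=; congr (_ + _).
rewrite (reindex_omap Some id); last by case.
by apply: eq_bigl => l; rewrite /= eqxx.
Qed.

Section time_averages.
Context {R : realType} {N L : nat} {dA : 'I_N -> measure_display}.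
Context {A : forall n : 'I_N, measurableType (dA n)}.
Context {d : measure_display} {Omega : measurableType d}.
Variables (M : renewal_model R L A) (P : probability Omega R).
Variable X : evolution R L A Omega.
Hypothesis run : is_run P M X.
Variables K B : R.
Hypothesis spec : frame_law_spec M.
Hypothesis bnd : uniform_bounds M K B.

Local Notation E f := (\int[P]_w f w)%R.

Definition path_total (i : option 'I_L) (T : nat) (w : Omega) : R :=
  \sum_(t < T) \sum_(n < N) component i (slot_at X n t w).

Definition mean_total (i : option 'I_L) (T : nat) : R := E (path_total i T).

Let K0 : 0 <= K := bound_ge0 bnd.

Lemma summable_component_at i n t :
  summable_rv P (fun w => component i (slot_at X n t w)).
Proof.
apply: (@summable_rv_bounded _ _ _ P K).
  exact: (measurable_component_at run).
have := good_run_ae run bnd; apply: filterS => w; exact: (good_component run).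
Qed.

Lemma summable_path_total i T : summable_rv P (path_total i T).
Proof.
apply: summable_rv_sum => t _; apply: summable_rv_sum => n _.
exact: summable_component_at.
Qed.

Lemma mean_totalE i T :
  (\sum_(0 <= t < T) \sum_(n < N) 'E_P[(fun w => component i (slot_at X n t w))]
   = (mean_total i T)%:E)%E.
Proof.
rewrite big_mkord /mean_total (@mean_sum _ _ _ P _ _ _
  (fun (t : 'I_T) w => \sum_(n < N) component i (slot_at X n t w))); last first.
  by move=> t _; apply: summable_rv_sum => n _; exact: summable_component_at.
rewrite -sumEFin; apply: eq_bigr => t _.
rewrite (@mean_sum _ _ _ P _ _ _
  (fun (n : 'I_N) w => component i (slot_at X n t w))); last first.
  by move=> n _; exact: summable_component_at.
rewrite -sumEFin; apply: eq_bigr => n _.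
rewrite unlock /Rintegral fineK//.
exact: (integrable_fin_num measurableT (summable_component_at i n t)).
Qed.

Lemma avg_penaltyE T : avg_penalty P X T = (T%:R^-1 * mean_total None T)%:E.
Proof. by rewrite /avg_penalty (mean_totalE None) EFinM. Qed.

Lemma avg_perfE l T : avg_perf P X l T = (T%:R^-1 * mean_total (Some l) T)%:E.
Proof. by rewrite /avg_perf (mean_totalE (Some l)) EFinM. Qed.

Lemma path_total_bound i T w : good_run X K w ->
  `|path_total i T w| <= N%:R * K * T%:R.
Proof.
move=> gw; apply: le_trans (ler_norm_sum _ _ _) _.
rewrite mulr_natr -[T in X in _ <= X]card_ord -sumr_const ler_sum// => t _.
apply: le_trans (ler_norm_sum _ _ _) _.
rewrite mulr_natl -[N in X in _ <= X]card_ord -sumr_const ler_sum// => n _.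
exact: (good_component run).
Qed.

Lemma mean_total_bound i T : `|mean_total i T| <= N%:R * K * T%:R.
Proof.
have s := summable_path_total i T.
have := good_run_ae run bnd => gae.
rewrite ler_norml; apply/andP; split.
- rewrite -[leLHS](mean_cst P); apply: mean_le_ae => //; first exact: summable_rv_cst.
  move: gae; apply: filterS => w gw.
  by have := path_total_bound i T gw; rewrite ler_norml => /andP[].
- rewrite -[leRHS](mean_cst P); apply: mean_le_ae => //; first exact: summable_rv_cst.
  move: gae; apply: filterS => w gw.
  by have := path_total_bound i T gw; rewrite ler_norml => /andP[].
Qed.

Lemma avg_total_bound i T : `|T%:R^-1 * mean_total i T| <= N%:R * K.
Proof.
rewrite normrM ger0_norm ?invr_ge0//.
have [->|T0] := eqVneq T 0%N; first by rewrite invr0 mul0r mulr_ge0.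
by rewrite ler_pdivrMl ?ltr0n ?lt0n// mulrC mean_total_bound.
Qed.

(** Each of the [N] systems costs [2 * K * B] per component, weighted by [x i]: the price of cutting
    its last frame at [T]. *)
Lemma constant_cost_lb (x : option 'I_L -> R) (m : R) (T : nat) :
  (forall i, 0 <= x i) ->
  (forall a : forall n, A n, m <= \sum_n \sum_i x i * ratio M i (a n)) ->
  T%:R * m - 2 * K * B * N%:R * \sum_i x i <= \sum_i x i * mean_total i T.
Proof.
move=> x0 hm.
(* The balance of deviations is an upper bound only; the weight -1 turns it into the lower bound
   needed here. *)
pose wd i n := weighted_deviation M X i n T (fun _ _ => -1).
have q_meas u : (u < T)%N ->
    measurable_fun setT ((fun=> -1) : g_sigma_algebraType (history X u) -> R).
  by move=> _; exact: measurable_cst.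
have q_bound (u : nat) w : (u < T)%N -> good_run X K w -> `|-1 : R| <= 1.
  by rewrite normrN1.
have s_wd i n : summable_rv P (wd i n).
  exact: (summable_weighted_deviation run spec bnd i n (q := fun _ _ => -1) ler01 q_meas q_bound).
have e_wd i n : E (wd i n) <= 2 * K * B.
  have := mean_weighted_deviation run spec bnd i n (q := fun _ _ => -1) ler01 q_meas q_bound.
  by rewrite mulr1.
pose S w := \sum_i \sum_(n < N) x i * wd i n w.
have s_S : summable_rv P S.
  apply: summable_rv_sum => i _; apply: summable_rv_sum => n _.
  exact: summable_rvZ.
have e_S : E S <= 2 * K * B * N%:R * \sum_i x i.
  rewrite /S (@mean_sum _ _ _ P _ _ _ (fun i w => \sum_(n < N) x i * wd i n w));
    last by move=> i _; apply: summable_rv_sum => n _; exact: summable_rvZ.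
  rewrite mulr_sumr; apply: ler_sum => i _.
  rewrite (@mean_sum _ _ _ P _ _ _ (fun n w => x i * wd i n w));
    last by move=> n _; exact: summable_rvZ.
  have -> : 2 * K * B * N%:R * x i = \sum_(n < N) x i * (2 * K * B).
    by rewrite sumr_const card_ord -mulr_natr; ring.
  by apply: ler_sum => n _; rewrite meanZ// ler_wpM2l.
pose Y w := \sum_i x i * path_total i T w.
have s_Y : summable_rv P Y.
  apply: summable_rv_sum => i _; apply: summable_rvZ; exact: summable_path_total.
have e_Y : E Y = \sum_i x i * mean_total i T.
  rewrite /Y (@mean_sum _ _ _ P _ _ _ (fun i w => x i * path_total i T w)).
    by apply: eq_bigr => i _; rewrite meanZ//; exact: summable_path_total.
  by move=> i _; apply: summable_rvZ; exact: summable_path_total.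
rewrite lerBlDr -e_Y; apply: le_trans (lerD (lexx _) e_S).
rewrite -meanD// -[leLHS](mean_cst P).
apply: mean_le; [exact: summable_rv_cst|exact: summable_rvD|] => w.
(* Adding the deviations replaces each observed component by the ratio of the action in force, so
   [hm] can be used slot by slot. *)
have -> : Y w + S w = \sum_(t < T) \sum_(n < N) \sum_i
    x i * ratio M i (action X n (current X n t w) w).
  rewrite exchange_big /=.
  under [RHS]eq_bigr do rewrite exchange_big /=.
  rewrite [RHS]exchange_big /= /Y /S -big_split /=; apply: eq_bigr => i _.
  rewrite /path_total exchange_big mulr_sumr -big_split /=; apply: eq_bigr => n _.
  rewrite /wd /weighted_deviation -mulrDr -[RHS]mulr_sumr; congr (_ * _).
  rewrite -big_split /=; apply: eq_bigr => t _.
  by rewrite /deviation mulN1r opprB addrC subrK.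
rewrite mulr_natl -[T in _ *+ T]card_ord -sumr_const; apply: ler_sum => t _.
exact: hm.
Qed.

End time_averages.

Section optimum.
Context {R : realType} {N L : nat} {dA : 'I_N -> measure_display}.
Context {A : forall n : 'I_N, measurableType (dA n)}.
Variable M : renewal_model R L A.
Variables K B : R.
Hypothesis spec : frame_law_spec M.
Hypothesis bnd : uniform_bounds M K B.

(** All time averages of all runs lie between [- (N%:R * K)] and [N%:R * K]; feasibility excludes
    the infimum over the empty set. *)
Lemma fstar_fin_num : feasible M -> exists f, fstar M = f%:E.
Proof.
move=> [v att]; exists (fine (fstar M)); rewrite fineK//.
have avgb d (Omega : measurableType d) (P : probability Omega R) X T :
    is_run P M X ->
    ((- (N%:R * K))%:E <= avg_penalty P X T <= (N%:R * K)%:E)%E.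
  move=> run; rewrite (avg_penaltyE run bnd) !lee_fin -ler_norml.
  exact: (avg_total_bound run bnd).
have objb w : attainable M w -> ((- (N%:R * K))%:E <= w <= (N%:R * K)%:E)%E.
  move=> [dd [Om [P [X [run _ ->]]]]]; apply/andP; split.
    by apply: limn_esup_ge => T; have /andP[] := avgb _ _ P X T run.
  by apply: limn_esup_le => T; have /andP[] := avgb _ _ P X T run.
rewrite fin_numElt; apply/andP; split.
  apply: (@lt_le_trans _ _ (- (N%:R * K))%:E); first exact: ltNyr.
  by apply: le_ereal_inf_tmp => w /objb /andP[].
apply: (@le_lt_trans _ _ (N%:R * K)%:E); last exact: ltry.
by apply: ge_ereal_inf; exists v => //; have /andP[] := objb _ att.
Qed.

(* Weak duality, proved on the runs themselves: it replaces the existence of an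
   optimal point of the performance region. *)
Lemma attainable_cost (f : R) (x : option 'I_L -> R) (m : R) :
  fstar M = f%:E -> (forall i, 0 <= x i) ->
  (forall a : forall n, A n, m <= \sum_n \sum_i x i * ratio M i (a n)) ->
  m <= x None * f + \sum_(l < L) x (Some l) * ext_mean M l.
Proof.
move=> fE x0 hm; apply/ler_addgt0Pr => e e0.
pose sx := \sum_i x i.
have sx0 : 0 <= sx by apply: sumr_ge0.
have sx1 : 0 < sx + 1 by rewrite ltr_wpDl.
(* The slack [del] is spent once per unit of weight, on the objective and the constraints, and once
   more on the cutting error [C / T%:R]; the total is [e]. *)
pose del := e / (sx + 1).
have del0 : 0 < del by rewrite divr_gt0.
have : (ereal_inf (attainable M) < (f + del)%:E)%E.
  by rewrite -/(fstar M) fE lte_fin ltrDl.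
move=> /ereal_inf_lt[_ [dd [Om [P [X [run sat ->]]]]]].
move=> /limn_esup_lt_eventually[m0 hm0].
have perf_ev l : exists ml, forall n, (ml <= n)%N ->
    (avg_perf P X l n < (ext_mean M l + del)%:E)%E.
  apply: limn_esup_lt_eventually; apply: le_lt_trans (sat l) _.
  by rewrite lte_fin ltrDl.
have [mm hmm] := boolp.choice perf_ev.
pose C := 2 * K * B * N%:R * sx.
have C0 : 0 <= C by rewrite !mulr_ge0// ?(bound_ge0 bnd) ?(residual_ge0 bnd).
have [m1 hm1] : exists m1 : nat, C / del <= m1%:R.
  by exists (Num.trunc (C / del)).+1; apply/ltW/truncnS_gt.
pose T := (m0 + \sum_(l < L) mm l + m1).+1.
have T0 : 0 < T%:R :> R by rewrite ltr0n.
have CT : C / T%:R <= del.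
  rewrite ler_pdivrMr// -ler_pdivrMl// mulrC; apply: le_trans hm1 _.
  by rewrite ler_nat /T; lia.
have hy : T%:R^-1 * mean_total P X None T <= f + del.
  rewrite -lee_fin -(avg_penaltyE run bnd); apply/ltW/hm0.
  by rewrite /T; lia.
have hz l : T%:R^-1 * mean_total P X (Some l) T <= ext_mean M l + del.
  rewrite -lee_fin -(avg_perfE run bnd); apply/ltW/hmm.
  by rewrite /T (bigD1 l)//=; lia.
have := constant_cost_lb run spec bnd T x0 hm; rewrite -/sx -/C => low.
have low' : m <= \sum_i x i * (T%:R^-1 * mean_total P X i T) + C / T%:R.
  have -> : \sum_i x i * (T%:R^-1 * mean_total P X i T)
      = T%:R^-1 * \sum_i x i * mean_total P X i T.
    by rewrite mulr_sumr; apply: eq_bigr => i _; rewrite mulrCA.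
  rewrite [C / _]mulrC -mulrDr ler_pdivlMl//.
  by rewrite -lerBlDr.
apply: le_trans low' _.
rewrite sum_option.
apply: (@le_trans _ _ (x None * (f + del)
    + \sum_(l < L) x (Some l) * (ext_mean M l + del) + del)).
  apply: lerD => //; apply: lerD; first by rewrite ler_wpM2l.
  by apply: ler_sum => l _; rewrite ler_wpM2l.
under eq_bigr do rewrite mulrDr.
rewrite big_split /= -mulr_suml.
have -> : e = del * (sx + 1) by rewrite /del divfK// gt_eqF.
rewrite /sx sum_option.
by rewrite le_eqVlt; apply/orP; left; apply/eqP; ring.
Qed.

End optimum.

(** * Independence of the external process from the queues *)

Section external.
Context {R : realType} {N L : nat} {dA : 'I_N -> measure_display}.
Context {A : forall n : 'I_N, measurableType (dA n)}.
Context {d : measure_display} {Omega : measurableType d}.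
Variables (M : renewal_model R L A) (P : probability Omega R).
Variable X : evolution R L A Omega.
Hypothesis run : is_run P M X.
Variables K B : R.
Hypothesis bnd : uniform_bounds M K B.

Local Notation hist t := (g_sigma_algebraType (history X t)).
Local Notation E f := (\int[P]_w f w)%R.

Let ext_kernel : R.-pker unit ~> L.-tuple R :=
  kprobability (measurable_cst (ext_law M : pprobability (L.-tuple R) R)).

Lemma summable_ext_coordinate l : summable_rv (ext_law M) (fun x => tnth x l).
Proof.
apply: (@summable_rv_bounded _ _ _ (ext_law M) K); first exact: measurable_tnth.
by have := ext_good bnd; apply: filterS => x; exact.
Qed.

Lemma measurable_ext_coordinate t l :
  measurable_fun setT (fun w => tnth (ext X t w) l).
Proof.
apply: (@measurableT_comp _ _ _ _ _ _ (fun x : L.-tuple R => tnth x l) _ (ext X t)).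
  exact: measurable_tnth.
exact: run_ext_meas run t.
Qed.

(** The disintegration is reused with a trivial action: the kernel is constant on [unit], and its
    rectangle identity is the independence of [ext X t] from the history. *)
Lemma ext_drift_le0 (q : Omega -> R) t l :
  measurable_fun setT (q : hist t -> R) ->
  (\int[P]_w (q w * (ext_mean M l - tnth (ext X t w) l))%:E <= 0)%E.
Proof.
move=> mq.
pose h (x : (hist t * unit) * L.-tuple R) : R :=
  q x.1.1 * (ext_mean M l - tnth x.2 l).
apply: (@disintegration_le0 R _ _ _ _ Omega (hist t) unit (L.-tuple R) P
  setT _ id (fun=> tt) (ext X t) _ _ _ ext_kernel _ h) => //.
- exact: (measurable_to_history run).
- exact: run_ext_meas run t.
- move=> H D C; rewrite historyE => mH _ mC.
  have [PC indep] := run_ext_iid run t mC.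
  have mH' := history_measurable run mH.
  have [Dtt|Dtt] := pselect (D tt).
    have -> : (fun=> tt) @^-1` D = [set: Omega] by apply/seteqP; split.
    rewrite !setIT setTI /= integral_cst//.
    by rewrite -PC muleC; exact: indep.
  have -> : (fun=> tt) @^-1` D = set0 :> set Omega by apply/seteqP; split.
  by rewrite setI0 set0I measure0 integral_set0.
- apply: measurable_funM.
    apply: (@measurableT_comp _ _ _ _ _ _ (q : hist t -> R) _
      (fun x : (hist t * unit) * L.-tuple R => x.1.1)); first exact: mq.
    exact: (measurableT_comp measurable_fst measurable_fst).
  apply: measurable_funB => //.
  exact: (measurableT_comp (measurable_tnth l) measurable_snd).
- move=> w _; have sl := summable_ext_coordinate l.
  have sd : summable_rv (ext_law M) (fun x => ext_mean M l - tnth x l).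
    by apply: summable_rvB => //; exact: summable_rv_cst.
  have s := summable_rvZ (q w) sd.
  split; first exact: s.
  rewrite /h /= -[leLHS]fineK; last first.
    exact: (integrable_fin_num measurableT s).
  rewrite lee_fin -/(Rintegral _ _ _) (meanZ _ sd).
  rewrite (meanB (summable_rv_cst _ _) sl) mean_cst.
  by rewrite /ext_mean subrr mulr0.
Qed.

End external.

(** * Drift plus penalty for the algorithm *)

Section algorithm.
Context {R : realType} {N L : nat} {dA : 'I_N -> measure_display}.
Context {A : forall n : 'I_N, measurableType (dA n)}.
Context {d : measure_display} {Omega : measurableType d}.
Variables (M : renewal_model R L A) (P : probability Omega R).
Variable X : evolution R L A Omega.
Hypothesis run : is_run P M X.
Variables K B : R.
Hypothesis spec : frame_law_spec M.
Hypothesis bnd : uniform_bounds M K B.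

Local Notation hist t := (g_sigma_algebraType (history X t)).
Local Notation E f := (\int[P]_w f w)%R.

Let K0 : 0 <= K := bound_ge0 bnd.

(** [N] performances and one external value enter a queue increment, each at most [K] in absolute
    value on a good run. *)
Definition increment_bound : R := N.+1%:R * K.

Local Notation K1 := increment_bound.

Let K10 : 0 <= K1.
Proof. by rewrite mulr_ge0. Qed.

Definition increment (t : nat) (w : Omega) (l : 'I_L) : R :=
  \sum_(n < N) tnth (perf X n t w) l - tnth (ext X t w) l.

Lemma increment_le t w l : good_run X K w -> `|increment t w l| <= K1.
Proof.
move=> gw; apply: le_trans (ler_normB _ _) _.
rewrite /K1 -natr1 mulrDl mul1r lerD//; last by have [_] := gw.
apply: le_trans (ler_norm_sum _ _ _) _.
rewrite mulr_natl -[N in X in _ <= X]card_ord -sumr_const ler_sum// => n _.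
exact: (good_component run (Some l) n t gw).
Qed.

Lemma queueS t w l :
  queue X t.+1 w l = Num.max (queue X t w l + increment t w l) 0.
Proof. by rewrite /= /increment addrA. Qed.

Lemma queue_ge0 t w l : 0 <= queue X t w l.
Proof. by case: t => //= t; rewrite le_max lexx orbT. Qed.

Lemma queue_step t w l : good_run X K w ->
  `|queue X t.+1 w l - queue X t w l| <= K1.
Proof.
move=> gw; have := increment_le t l gw; rewrite ler_norml => /andP[lo hi].
have q0 := queue_ge0 t w l; rewrite queueS ler_norml.
by have [neg|pos] := leP (queue X t w l + increment t w l) 0;
  apply/andP; split; lra.
Qed.

Lemma queue_lipschitz s t w l : good_run X K w -> (s <= t)%N ->
  `|queue X t w l - queue X s w l| <= K1 * (t - s)%:R.
Proof.
move=> gw; elim: t => [|t ih].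
  by rewrite leqn0 => /eqP ->; rewrite subrr normr0 mulr0.
rewrite leq_eqVlt => /predU1P[->|]; first by rewrite subrr normr0 subnn mulr0.
rewrite ltnS => st; rewrite subSn// -natr1 mulrDr mulr1.
have -> : queue X t.+1 w l - queue X s w l
    = (queue X t w l - queue X s w l) + (queue X t.+1 w l - queue X t w l) by ring.
by apply: le_trans (ler_normD _ _) _; rewrite lerD ?ih// queue_step.
Qed.

Lemma queue_le t w l : good_run X K w -> `|queue X t w l| <= K1 * t%:R.
Proof.
by move=> gw; have := queue_lipschitz l gw (leq0n t); rewrite /= subr0 subn0.
Qed.

Lemma measurable_queue t l : measurable_fun setT (fun w => queue X t w l).
Proof.
move=> _ D mD; apply: (history_measurable run (t := t)).
rewrite -historyE; have mq := @history_queue _ _ _ _ _ _ _ X l t t (leqnn t); exact: mq.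
Qed.

Lemma sum_increment_le T w l : \sum_(t < T) increment t w l <= queue X T w l.
Proof.
elim: T => [|T ih]; first by rewrite big_ord0.
rewrite big_ord_recr queueS le_max; apply/orP; left.
by rewrite lerD2r.
Qed.

(** Truncation at 0 can only decrease the square, so the square of the queue telescopes with an
    error of one squared increment per slot. *)
Lemma queue_square_drift T w l : good_run X K w ->
  queue X T w l ^+ 2 <=
    2 * (\sum_(t < T) queue X t w l * increment t w l) + T%:R * K1 ^+ 2.
Proof.
move=> gw; elim: T => [|T ih].
  by rewrite big_ord0 /= expr0n mulr0 mul0r addr0.
have step : queue X T.+1 w l ^+ 2 <= (queue X T w l + increment T w l) ^+ 2.
  rewrite queueS; case: (leP (queue X T w l + increment T w l) 0) => // _.
    by rewrite expr0n sqr_ge0.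
have inc : increment T w l ^+ 2 <= K1 ^+ 2.
  by rewrite -[leLHS]real_normK ?num_real// lerXn2r ?nnegrE ?increment_le.
apply: le_trans step _.
rewrite big_ord_recr -natr1 /= sqrrD.
set q := queue X T w l in ih *; set S := (\sum_(t < T) _) in ih *.
set inc' := increment T w l in inc *.
rewrite mulrDl mul1r mulrDr; lra.
Qed.

Variables (V : R) (V0 : 0 <= V).

Definition weight (i : option 'I_L) (t : nat) (w : Omega) : R :=
  if i is Some l then queue X t w l else V.

Lemma weight_ge0 i t w : 0 <= weight i t w.
Proof. by case: i => [l|] //=; exact: queue_ge0. Qed.

Lemma weight_le i t T w : (t < T)%N -> good_run X K w ->
  `|weight i t w| <= V + K1 * T%:R.
Proof.
move=> tT gw; case: i => [l|] /=; last first.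
  by rewrite ger0_norm// lerDl mulr_ge0.
apply: le_trans (queue_le t l gw) _; apply: ler_wpDl => //.
by rewrite ler_wpM2l// ler_nat ltnW.
Qed.

Lemma history_weight i t : measurable_fun setT (weight i t : hist t -> R).
Proof.
by case: i => [l|]; [exact: history_queue|exact: measurable_cst].
Qed.

Lemma algorithm_costE n (a : A n) t w :
  algorithm_cost M V (queue X t w) a = \sum_i weight i t w * ratio M i a.
Proof.
rewrite sum_option /algorithm_cost; congr (_ + _).
by apply: eq_bigr => l _; rewrite ratio_Some.
Qed.

(** The penalty weight [V] is constant and cancels; the [L] queues have each moved by at most [K1]
    times the age of the frame. *)
Lemma weight_lipschitz n t w (c : option 'I_L -> R) :
  good_run X K w -> (forall i, `|c i| <= K) ->
  `|\sum_i (weight i t w - weight i (start X n t w) w) * c i|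
    <= L%:R * K1 * K * (t - start X n t w)%:R.
Proof.
move=> gw cK; have /andP[st _] := currentP run n t w.
rewrite sum_option /= subrr mul0r add0r.
apply: le_trans (ler_norm_sum _ _ _) _.
have -> : L%:R * K1 * K * (t - start X n t w)%:R
    = \sum_(l < L) (K1 * (t - start X n t w)%:R) * K.
  by rewrite sumr_const card_ord -mulr_natl; ring.
apply: ler_sum => l _; rewrite normrM ler_pM//.
exact: queue_lipschitz.
Qed.

Hypothesis algo : follows_algorithm M V X.
Variable f : R.
Hypothesis fstarE : fstar M = f%:E.

(** Optimality of an action holds only at the queues seen when its frame began, and the systems
    begin their frames at different slots. Lipschitz continuity brings all of them to the common
    queues at [t], where a single comparison with [f] is possible. *)
Lemma slot_cost_le t w : good_run X K w ->
  \sum_n \sum_i weight i t w * component i (slot_at X n t w) <=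
  \sum_n \sum_i weight i (start X n t w) w
      * deviation M X i n (current X n t w) t w
  + (V * f + \sum_(l < L) queue X t w l * ext_mean M l)
  + 2 * L%:R * K1 * K * \sum_n (t - start X n t w)%:R.
Proof.
move=> gw.
pose D n : R := L%:R * K1 * K * (t - start X n t w)%:R.
pose act n := action X n (current X n t w) w.
(* Cost of the chosen actions at the frame starts, lowered by the Lipschitz error [D]. It lies below
   the cost of every choice of actions at the present queues, which is what [attainable_cost] asks
   for at this sample point. *)
pose m := \sum_n (\sum_i weight i (start X n t w) w * ratio M i (act n) - D n).
have m_le : m <= V * f + \sum_(l < L) queue X t w l * ext_mean M l.
  apply: (attainable_cost spec bnd fstarE (fun i => weight_ge0 i t w)) => a.
  apply: ler_sum => n _.
  have := algo (current X n t w) w (a n).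
  rewrite !algorithm_costE -/(start X n t w) => /le_trans le1.
  rewrite lerBlDr; apply: le1.
  have rK i : `|ratio M i (a n)| <= K by exact: (ratio_bound spec bnd 0%N).
  have := weight_lipschitz n t gw rK; rewrite ler_norml => /andP[lo _].
  move: lo; under eq_bigr do rewrite mulrBl.
  rewrite sumrB -/(D n); lra.
(* One [D] pays for moving the observed values from the present queues to those at the frame start,
   the other for the [D] subtracted in [m]. *)
have comp_le n : \sum_i weight i t w * component i (slot_at X n t w) <=
    \sum_i weight i (start X n t w) w
      * deviation M X i n (current X n t w) t w
    + (\sum_i weight i (start X n t w) w * ratio M i (act n) - D n) + 2 * D n.
  have cK i := good_component run i n t gw.
  have := weight_lipschitz n t gw cK; rewrite ler_norml => /andP[_ hi].
  move: hi; under eq_bigr do rewrite mulrBl.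
  rewrite sumrB -/(D n).
  have -> : \sum_i weight i (start X n t w) w
      * deviation M X i n (current X n t w) t w
    = \sum_i weight i (start X n t w) w * component i (slot_at X n t w)
      - \sum_i weight i (start X n t w) w * ratio M i (act n).
    by rewrite -sumrB; apply: eq_bigr => i _; rewrite -mulrBr.
  lra.
apply: le_trans (ler_sum _ (fun n _ => comp_le n)) _.
rewrite !big_split /=; move: m_le; rewrite /m big_split /= => m_le.
have -> : 2 * L%:R * K1 * K * \sum_n (t - start X n t w)%:R = \sum_n 2 * D n.
  by rewrite mulr_sumr; apply: eq_bigr => n _; rewrite /D; ring.
by rewrite lerD2r lerD2l.
Qed.

End algorithm.

Section drift_bound.
Context {R : realType} {N L : nat} {dA : 'I_N -> measure_display}.
Context {A : forall n : 'I_N, measurableType (dA n)}.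
Context {d : measure_display} {Omega : measurableType d}.
Variables (M : renewal_model R L A) (P : probability Omega R).
Variable X : evolution R L A Omega.
Hypothesis run : is_run P M X.
Variables K B : R.
Hypothesis spec : frame_law_spec M.
Hypothesis bnd : uniform_bounds M K B.

Local Notation E f := (\int[P]_w f w)%R.
Local Notation K1 := (@increment_bound R N K).

Let K0 : 0 <= K := bound_ge0 bnd.
Let B0 : 0 <= B := residual_ge0 bnd.
Let K10 : 0 <= K1.
Proof. by rewrite mulr_ge0. Qed.

Definition ext_drift (l : 'I_L) (T : nat) (w : Omega) : R :=
  \sum_(t < T) queue X t w l * (ext_mean M l - tnth (ext X t w) l).

Lemma summable_ext_product (q : Omega -> R) (C : R) t l :
  measurable_fun setT q -> (forall w, good_run X K w -> `|q w| <= C) ->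
  summable_rv P (fun w => q w * (ext_mean M l - tnth (ext X t w) l)).
Proof.
move=> mq qC.
apply: (@summable_rv_bounded _ _ _ P (C * (`|ext_mean M l| + K))).
  apply: measurable_funM => //; apply: measurable_funB => //.
  exact: (measurable_ext_coordinate run).
have := good_run_ae run bnd; apply: filterS => w gw.
rewrite normrM ler_pM ?qC//.
by apply: le_trans (ler_normB _ _) _; rewrite lerD2l; have [_] := gw.
Qed.

Lemma mean_ext_product_le0 (q : Omega -> R) (C : R) t l :
  measurable_fun setT (q : g_sigma_algebraType (history X t) -> R) ->
  (forall w, good_run X K w -> `|q w| <= C) ->
  E (fun w => q w * (ext_mean M l - tnth (ext X t w) l)) <= 0.
Proof.
move=> hq qC.
have mq : measurable_fun setT q.
  move=> _ D mD; apply: (history_measurable run (t := t)).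
  by rewrite -historyE; exact: hq.
have s := summable_ext_product t l mq qC.
rewrite -lee_fin /Rintegral fineK; last exact: (integrable_fin_num measurableT s).
exact: (ext_drift_le0 run bnd).
Qed.

Lemma summable_ext_drift l T : summable_rv P (ext_drift l T).
Proof.
apply: summable_rv_sum => t _; apply: (@summable_ext_product _ (K1 * t%:R)).
  exact: (measurable_queue run).
by move=> w gw; exact: (queue_le run).
Qed.

Lemma mean_ext_drift l T : E (ext_drift l T) <= 0.
Proof.
rewrite /ext_drift (@mean_sum _ _ _ P _ _ _
  (fun (t : 'I_T) w => queue X t w l * (ext_mean M l - tnth (ext X t w) l))).
  apply: sumr_le0 => t _; apply: (@mean_ext_product_le0 _ (K1 * t%:R)).
    exact: history_queue.
  by move=> w gw; exact: (queue_le run).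
move=> t _; apply: (@summable_ext_product _ (K1 * t%:R)).
  exact: (measurable_queue run).
by move=> w gw; exact: (queue_le run).
Qed.

Lemma summable_queue t l : summable_rv P (fun w => queue X t w l).
Proof.
apply: (@summable_rv_bounded _ _ _ P (K1 * t%:R)).
  exact: (measurable_queue run).
by have := good_run_ae run bnd; apply: filterS => w gw; exact: (queue_le run).
Qed.

Lemma summable_queue_square t l : summable_rv P (fun w => queue X t w l ^+ 2).
Proof.
apply: (@summable_rv_bounded _ _ _ P ((K1 * t%:R) ^+ 2)).
  by apply: measurable_funX; exact: (measurable_queue run).
have := good_run_ae run bnd; apply: filterS => w gw.
by rewrite normrX lerXn2r ?nnegrE ?mulr_ge0// (queue_le run).
Qed.

(** The queue dominates the sum of its increments. The external values in that sum are compared with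
    their mean through the constant weight -1, which gives the required direction of the one-sided
    estimate. *)
Lemma mean_perf_le_queue l T :
  mean_total P X (Some l) T - T%:R * ext_mean M l <= E (fun w => queue X T w l).
Proof.
pose S w := \sum_(t < T) (- 1) * (ext_mean M l - tnth (ext X t w) l).
have m1 w : good_run X K w -> `|(fun=> - 1 : R) w| <= 1 by rewrite normrN1.
have s_t t : summable_rv P
    (fun w => (- 1) * (ext_mean M l - tnth (ext X t w) l)).
  by apply: (@summable_ext_product (fun=> -1) 1).
have s_S : summable_rv P S by apply: summable_rv_sum => t _.
have e_S : E S <= 0.
  rewrite /S (@mean_sum _ _ _ P _ _ _
    (fun (t : 'I_T) w => (-1) * (ext_mean M l - tnth (ext X t w) l)))//.
  apply: sumr_le0 => t _; apply: (@mean_ext_product_le0 (fun=> -1) 1) => //.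
rewrite lerBlDr; apply: (@le_trans _ _
  (E (fun w => queue X T w l) + (E S + T%:R * ext_mean M l))); last first.
  by rewrite lerD2l gerDr.
rewrite -[T%:R * _](mean_cst P) -meanD//; last exact: summable_rv_cst.
have s_2 := summable_rvD s_S (summable_rv_cst P (T%:R * ext_mean M l)).
rewrite -meanD//; last exact: summable_queue.
apply: mean_le.
- exact: (summable_path_total run bnd).
- by apply: summable_rvD => //; exact: summable_queue.
move=> w; have := sum_increment_le X T w l.
rewrite /increment sumrB /S /path_total => le1.
have -> : \sum_(t < T) -1 * (ext_mean M l - tnth (ext X t w) l)
    = \sum_(t < T) tnth (ext X t w) l - T%:R * ext_mean M l.
  have -> : T%:R * ext_mean M l = \sum_(t < T) ext_mean M l.
    by rewrite sumr_const card_ord mulr_natl.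
  rewrite -sumrB.
  by apply: eq_bigr => t _; rewrite mulN1r opprB.
by rewrite subrK -lerBlDr.
Qed.

Variables (V : R) (V0 : 0 <= V).
Hypothesis algo : follows_algorithm M V X.
Variable f : R.
Hypothesis fstarE : fstar M = f%:E.

(** The queues multiply the realised external values in the drift but the means in the comparison
    with [f]; the mismatch is [ext_drift], which has nonpositive mean. *)
Lemma path_drift_plus_penalty T w : good_run X K w ->
  \sum_(l < L) queue X T w l ^+ 2 + 2 * V * path_total X None T w
  <= 2 * (\sum_i \sum_n weighted_deviation M X i n T (weight X V i) w)
     + 2 * T%:R * V * f + 2 * (\sum_(l < L) ext_drift l T w)
     + 4 * L%:R * K1 * K * (\sum_n total_age X n T w)
     + L%:R * (T%:R * K1 ^+ 2).
Proof.
move=> gw.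
have sq : \sum_(l < L) queue X T w l ^+ 2
    <= 2 * (\sum_(t < T) \sum_(l < L) queue X t w l * increment X t w l)
       + L%:R * (T%:R * K1 ^+ 2).
  rewrite exchange_big /= mulr_sumr.
  have -> : L%:R * (T%:R * K1 ^+ 2) = \sum_(l < L) T%:R * K1 ^+ 2.
    by rewrite sumr_const card_ord mulr_natl.
  rewrite -big_split /=; apply: ler_sum => l _.
  exact: (queue_square_drift run bnd).
have costE t : V * (\sum_(n < N) penalty X n t w)
      + \sum_(l < L) queue X t w l * increment X t w l
    = \sum_n \sum_i weight X V i t w * component i (slot_at X n t w)
      - \sum_(l < L) queue X t w l * tnth (ext X t w) l.
  under [X in _ = X - _]eq_bigr do rewrite sum_option /=.
  rewrite big_split /= -mulr_sumr exchange_big /= -addrA -sumrB.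
  congr (_ + _); apply: eq_bigr => l _.
  by rewrite /increment mulrBr mulr_sumr.
have tot := ler_sum (index_enum 'I_T) (P := xpredT)
  (fun (t : 'I_T) _ => slot_cost_le run spec bnd V0 algo fstarE t gw).
move: tot; rewrite !big_split /= => tot.
have e1 : \sum_(t < T) \sum_n \sum_i weight X V i (start X n t w) w
      * deviation M X i n (current X n t w) t w
    = \sum_i \sum_n weighted_deviation M X i n T (weight X V i) w.
  rewrite exchange_big /=.
  under eq_bigr do rewrite exchange_big /=.
  by rewrite exchange_big.
have e2 : \sum_(t < T) V * f = T%:R * V * f.
  by rewrite sumr_const card_ord -mulrA mulr_natl.
have e3 : \sum_(t < T) \sum_(l < L) queue X t w l * ext_mean M l
    = \sum_(l < L) ext_drift l T w
      + \sum_(t < T) \sum_(l < L) queue X t w l * tnth (ext X t w) l.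
  rewrite exchange_big [X in _ + X]exchange_big /= -big_split /=.
  apply: eq_bigr => l _; rewrite /ext_drift -big_split /=.
  by apply: eq_bigr => t _; rewrite mulrBr subrK.
have e4 : \sum_(t < T) 2 * L%:R * K1 * K * \sum_n (t - start X n t w)%:R
    = 2 * L%:R * K1 * K * \sum_n total_age X n T w.
  by rewrite -mulr_sumr exchange_big.
move: tot; rewrite e1 e2 e3 e4 => tot.
have e5 : V * path_total X None T w
      + \sum_(t < T) \sum_(l < L) queue X t w l * increment X t w l
    = \sum_(t < T) \sum_n \sum_i weight X V i t w * component i (slot_at X n t w)
      - \sum_(t < T) \sum_(l < L) queue X t w l * tnth (ext X t w) l.
  rewrite /path_total mulr_sumr -big_split -sumrB /=.
  by apply: eq_bigr => t _; exact: costE.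
lra.
Qed.

(** The three summands come from the squared increments of the [L] queues, from the cutting error of
    [N] systems with [L.+1] components each, and from the ages of the frames. *)
Definition drift_constant : R :=
  L%:R * K1 ^+ 2 + 4 * K * B * N%:R * L.+1%:R * (1 + K1)
  + 4 * L%:R * K1 * K * N%:R * B.

Lemma mean_drift_plus_penalty T :
  \sum_(l < L) E (fun w => queue X T w l ^+ 2) + 2 * V * mean_total P X None T
  <= 2 * V * f * T%:R + drift_constant * (V + T%:R).
Proof.
pose W w := \sum_i \sum_n weighted_deviation M X i n T (weight X V i) w.
have C0 : 0 <= V + K1 * T%:R by rewrite addr_ge0// mulr_ge0.
have qh i u : (u < T)%N -> measurable_fun setT
    (weight X V i u : g_sigma_algebraType (history X u) -> R).
  by move=> _; exact: history_weight.
have qb i u w : (u < T)%N -> good_run X K w ->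
    `|weight X V i u w| <= V + K1 * T%:R.
  by move=> uT gw; exact: (weight_le run bnd V0).
have s_wd i n := summable_weighted_deviation run spec bnd i n C0 (qh i) (qb i).
have e_wd i n := mean_weighted_deviation run spec bnd i n C0 (qh i) (qb i).
have s_W : summable_rv P W.
  by apply: summable_rv_sum => i _; apply: summable_rv_sum => n _.
have e_W : E W <= L.+1%:R * (N%:R * (2 * K * (V + K1 * T%:R) * B)).
  rewrite /W (@mean_sum _ _ _ P _ _ _ (fun i w =>
    \sum_n weighted_deviation M X i n T (weight X V i) w)); last first.
    by move=> i _; apply: summable_rv_sum => n _.
  have -> : L.+1 = #|{: option 'I_L}| by rewrite card_option card_ord.
  rewrite [leRHS]mulr_natl -sumr_const; apply: ler_sum => i _.
  rewrite (@mean_sum _ _ _ P _ _ _ (fun n w =>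
    weighted_deviation M X i n T (weight X V i) w))//.
  rewrite [leRHS]mulr_natl -[N in _ *+ N]card_ord -sumr_const.
  by apply: ler_sum => n _; exact: e_wd.
pose D w := \sum_(l < L) ext_drift l T w.
have s_D : summable_rv P D.
  by apply: summable_rv_sum => l _; exact: summable_ext_drift.
have e_D : E D <= 0.
  rewrite /D (@mean_sum _ _ _ P _ _ _ (fun l w => ext_drift l T w)).
    by apply: sumr_le0 => l _; exact: mean_ext_drift.
  by move=> l _; exact: summable_ext_drift.
pose G w := \sum_n total_age X n T w.
have age n := mean_total_age run bnd n T.
have s_G : summable_rv P G by apply: summable_rv_sum => n _; have [] := age n.
have e_G : E G <= N%:R * (B * T%:R).
  rewrite /G (@mean_sum _ _ _ P _ _ _ (fun n w => total_age X n T w)).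
    rewrite [leRHS]mulr_natl -[N in _ *+ N]card_ord -sumr_const.
    by apply: ler_sum => n _; have [] := age n.
  by move=> n _; have [] := age n.
pose Q w := \sum_(l < L) queue X T w l ^+ 2.
have s_Q : summable_rv P Q.
  by apply: summable_rv_sum => l _; exact: summable_queue_square.
have e_Q : E Q = \sum_(l < L) E (fun w => queue X T w l ^+ 2).
  rewrite /Q (@mean_sum _ _ _ P _ _ _ (fun l w => queue X T w l ^+ 2))//.
  by move=> l _; exact: summable_queue_square.
have s_Y := summable_path_total run bnd None T.
have main : E Q + 2 * V * mean_total P X None T
    <= 2 * E W + 2 * T%:R * V * f + 2 * E D
       + 4 * L%:R * K1 * K * E G + L%:R * (T%:R * K1 ^+ 2).
  rewrite /mean_total -meanZ// -meanD//; last exact: summable_rvZ.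
  have s1 := summable_rvZ 2 s_W.
  have s2 := summable_rv_cst P (2 * T%:R * V * f).
  have s3 := summable_rvZ 2 s_D.
  have s4 := summable_rvZ (4 * L%:R * K1 * K) s_G.
  have s5 := summable_rv_cst P (L%:R * (T%:R * K1 ^+ 2)).
  have s12 := summable_rvD s1 s2.
  have s123 := summable_rvD s12 s3.
  have s1234 := summable_rvD s123 s4.
  rewrite -(meanZ 2 s_W) -(meanZ 2 s_D) -(meanZ _ s_G).
  rewrite -[X in _ + X + _ + _ + _](mean_cst P) -[X in _ + X](mean_cst P).
  rewrite -(meanD s1 s2) -(meanD s12 s3) -(meanD s123 s4) -(meanD s1234 s5).
  apply: mean_le_ae.
  - by apply: summable_rvD => //; exact: summable_rvZ.
  - exact: summable_rvD.
  have := good_run_ae run bnd; apply: filterS => w gw.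
  exact: path_drift_plus_penalty.
rewrite -e_Q; apply: le_trans main _.
have hT : 0 <= T%:R :> R by [].
have LN0 : 0 <= 4 * L%:R * K1 * K by rewrite !mulr_ge0.
have e_G' := ler_wpM2l LN0 e_G.
(* The weights reach [V + K1 * T%:R]; factoring out [V + T%:R] explains the [1 + K1] in
   [drift_constant]. *)
have VT : L.+1%:R * (N%:R * (2 * K * (V + K1 * T%:R) * B))
    <= L.+1%:R * (N%:R * (2 * K * ((1 + K1) * (V + T%:R)) * B)).
  have h1 : V + K1 * T%:R <= (1 + K1) * (V + T%:R).
    by have := mulr_ge0 K10 V0; lra.
  by rewrite !(ler_wpM2l, ler_wpM2r)// mulr_ge0.
have t1 : L%:R * K1 ^+ 2 * T%:R <= L%:R * K1 ^+ 2 * (V + T%:R).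
  by rewrite ler_wpM2l ?lerDr// mulr_ge0// sqr_ge0.
have t2 : 4 * L%:R * K1 * K * N%:R * B * T%:R
    <= 4 * L%:R * K1 * K * N%:R * B * (V + T%:R).
  by rewrite ler_wpM2l ?lerDr// !mulr_ge0.
rewrite /drift_constant; lra.
Qed.

End drift_bound.

(** * Lagrange multipliers and the final estimates *)

Lemma lagrange_ratios (R : realType) (N L : nat) (dA : 'I_N -> measure_display)
    (A : forall n : 'I_N, measurableType (dA n)) (M : renewal_model R L A)
    (f : R) :
  fstar M = f%:E -> lagrange_assumption M ->
  exists2 g : 'I_L -> R, (forall l, 0 <= g l) &
    forall a : forall n, A n,
      f + \sum_l g l * ext_mean M l
      <= \sum_n \sum_i (if i is Some l then g l else 1) * ratio M i (a n).
Proof.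
move=> fE [g g0 hg]; exists g => // a.
have := hg (fun n => (fhat M (a n), ghat M (a n))); rewrite fE -EFinD lee_fin /=.
have -> : \sum_n \sum_i (if i is Some l then g l else 1) * ratio M i (a n)
    = \sum_n fhat M (a n) + \sum_l g l * \sum_n ghat M (a n) 0 l.
  under eq_bigr do rewrite sum_option /= mul1r.
  rewrite big_split /= exchange_big /=; congr (_ + _).
  apply: eq_bigr => l _; rewrite mulr_sumr; apply: eq_bigr => n _.
  by rewrite ratio_Some.
apply => n.
exists (mean_penalty M (a n), mean_perf M (a n), mean_length M (a n)) => //.
(* A single action is a convex combination with one point, so its ratios lie in the performance
   region. *)
exists 1%N, (fun=> 1), (fun=> (mean_penalty M (a n), mean_perf M (a n), mean_length M (a n))).
split => //.
- by rewrite big_ord1.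
- by move=> _; exists (a n).
- by rewrite big_ord1 scale1r.
Qed.

(** Solves the quadratic inequality for the mean queues without square roots: the second moment is
    replaced by its tangent [2 * c * q l - c ^+ 2], with [c] free. Here [s] will be [eps * T%:R]. *)
Lemma mean_queue_bound (R : realFieldType) (L : nat) (g q sq : 'I_L -> R)
    (V s T C1 C2 : R) :
  (forall l, 0 <= g l) -> (forall l, 0 <= q l) ->
  (forall c l, 2 * c * q l - c ^+ 2 <= sq l) ->
  0 <= C1 -> 0 <= C2 -> 1 <= s -> 0 <= V <= s -> T <= s ^+ 2 ->
  \sum_l sq l <= 2 * V * (\sum_l g l * q l + C2) + C1 * (V + T) ->
  forall l, q l <= s * (L%:R * (1 + \sum_l g l) ^+ 2 + 2 * C2 + 2 * C1).
Proof.
move=> g0 q0 hsq C10 C20 s1 /andP[V0 Vs] Ts hsum l.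
have s0 : 0 < s by exact: lt_le_trans s1.
(* With this slope [2 * c] absorbs the multiplier term [2 * V * g l], as [V <= s], and still leaves
   [2 * s] in front of each [q l]. All remaining terms are of order [s ^+ 2], so division by [s]
   finishes. *)
pose kap := 1 + \sum_l g l; pose c := kap * s.
have low : 2 * c * \sum_l q l - L%:R * c ^+ 2 <= \sum_l sq l.
  have -> : 2 * c * \sum_l q l - L%:R * c ^+ 2 = \sum_l (2 * c * q l - c ^+ 2).
    by rewrite sumrB -mulr_sumr sumr_const card_ord [L%:R * _]mulr_natl.
  by apply: ler_sum => j _.
have gq : 2 * V * \sum_l g l * q l + 2 * s * \sum_l q l <= 2 * c * \sum_l q l.
  rewrite !mulr_sumr -big_split /=; apply: ler_sum => j _.
  have gj : g j <= \sum_l g l.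
    by rewrite (bigD1 j)//= lerDl; apply: sumr_ge0.
  have h1 : V * (g j * q j) <= s * (g j * q j) by rewrite ler_wpM2r ?mulr_ge0.
  have h2 : s * (g j * q j) <= s * ((\sum_l g l) * q j).
    by apply: (ler_wpM2l (ltW s0)); exact: ler_wpM2r.
  by rewrite /c /kap; lra.
have ql : q l <= \sum_l q l by rewrite (bigD1 l)//= lerDl; apply: sumr_ge0.
have ss : s <= s ^+ 2 by rewrite expr2 ler_peMr// ltW.
have h3 : V * C2 <= s ^+ 2 * C2 by rewrite ler_wpM2r// (le_trans Vs).
have h4 : C1 * (V + T) <= C1 * (2 * s ^+ 2).
  by rewrite ler_wpM2l//; have := le_trans Vs ss; lra.
have h5 : s * q l <= s * \sum_l q l by rewrite ler_wpM2l// ltW.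
rewrite -(ler_pM2l s0) -/kap.
have -> : s * (s * (L%:R * kap ^+ 2 + 2 * C2 + 2 * C1))
    = L%:R * c ^+ 2 + 2 * (s ^+ 2 * C2) + C1 * (2 * s ^+ 2) by rewrite /c; ring.
have c20 : 0 <= L%:R * c ^+ 2 by rewrite mulr_ge0 ?sqr_ge0.
have sC2 : 0 <= s ^+ 2 * C2 by rewrite mulr_ge0 ?sqr_ge0.
have sC1 : 0 <= C1 * (2 * s ^+ 2) by apply: mulr_ge0 => //; rewrite mulr_ge0 ?sqr_ge0.
lra.
Qed.

Theorem theorem2p4p1 (R : realType) (N L : nat) (dA : 'I_N -> measure_display)
    (A : forall n : 'I_N, measurableType (dA n)) (M : renewal_model R L A) :
  standing_assumptions M -> feasible M -> lagrange_assumption M ->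
  exists C : R, forall eps : R, 0 < eps < 1 ->
    forall (d : measure_display) (Omega : measurableType d)
      (P : probability Omega R) (X : evolution R L A Omega),
      is_run P M X -> follows_algorithm M (eps^-1) X ->
      forall T : nat, 1 / eps ^+ 2 <= T%:R ->
        (avg_penalty P X T <= fstar M + (C * eps)%:E)%E /\
        (forall l : 'I_L, (avg_perf P X l T <= (ext_mean M l + C * eps)%:E)%E).
Proof.
move=> stand feas lagr.
have [K [B bnd]] := uniform_bounds_exist stand.
have [spec _ _ _] := stand.
have [f fE] := fstar_fin_num bnd feas.
have [g g0 hg] := lagrange_ratios fE lagr.
have K0 := bound_ge0 bnd; have B0 := residual_ge0 bnd.
pose x (i : option 'I_L) : R := if i is Some l then g l else 1.
have x0 i : 0 <= x i by case: i => [l|] //=.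
pose C1 := @drift_constant R N L K B.
have C10 : 0 <= C1.
  have k0 : 0 <= @increment_bound R N K by rewrite mulr_ge0.
  by rewrite /C1 /drift_constant !(addr_ge0, mulr_ge0, sqr_ge0).
pose C2 := 2 * K * B * N%:R * \sum_i x i.
have C20 : 0 <= C2 by rewrite !mulr_ge0// sumr_ge0.
pose C3 := L%:R * (1 + \sum_l g l) ^+ 2 + 2 * C2 + 2 * C1.
have C30 : 0 <= C3.
  by apply: addr_ge0; [apply: addr_ge0|]; apply: mulr_ge0 => //; exact: sqr_ge0.
(* [C1] measures the drift error and [C3] is the bound on the mean queues per unit of [eps * T%:R];
   neither depends on [eps], [T] or the run. *)
exists (C1 + C3) => eps /andP[e0 e1] d Omega P X run algo T hT.
have hT1 : 1 <= eps ^+ 2 * T%:R.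
  by rewrite mulrC -ler_pdivrMr// exprn_gt0.
pose V := eps^-1; have V0 : 0 < V by rewrite invr_gt0.
have Ve : V * eps = 1 by rewrite mulVf// gt_eqF.
(* The assumption on [T] enters only as [1 <= eps ^+ 2 * T%:R]. In terms of [s = eps * T%:R] it
   becomes [V <= s] and [T%:R <= s ^+ 2], the scales of [mean_queue_bound]. *)
have T0 : 0 < T%:R :> R.
  by apply: lt_le_trans hT; rewrite divr_gt0// exprn_gt0.
pose s := eps * T%:R.
have Vs : V <= s.
  rewrite /s -[V]mulr1 -(ler_pM2l e0) mulrA [eps * V]mulrC Ve mul1r mulrA -expr2.
  exact: hT1.
have V1 : 1 <= V by rewrite invf_ge1// ltW.
have Ts : T%:R <= s ^+ 2.
  rewrite /s exprMn expr2 [T%:R ^+ 2]expr2 mulrA.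
  by apply: ler_peMl; rewrite -?expr2 ?(ltW T0).
pose q l := \int[P]_w queue X T w l.
have q0 l : 0 <= q l by apply: Rintegral_ge0 => w _; exact: queue_ge0.
pose sq l := \int[P]_w (queue X T w l ^+ 2).
(* Expectation of the nonnegative square of [queue X T w l - c]. *)
have sq_low c l : 2 * c * q l - c ^+ 2 <= sq l.
  have s1 := summable_queue run bnd T l.
  have s2 := summable_queue_square run bnd T l.
  rewrite /q /sq -(meanZ _ s1) -[c ^+ 2](mean_cst P).
  have sc := summable_rv_cst P (c ^+ 2).
  rewrite -meanB//; last exact: summable_rvZ.
  apply: mean_le => //; first by apply: summable_rvB => //; exact: summable_rvZ.
  by move=> w; have := sqr_ge0 (queue X T w l - c); rewrite sqrrB; lra.
have drift := mean_drift_plus_penalty run spec bnd (ltW V0) algo fE T.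
have dual := constant_cost_lb run spec bnd T x0 hg.
rewrite -/x -/C2 sum_option /= mul1r in dual.
pose Y := mean_total P X None T; pose Z l := mean_total P X (Some l) T.
have Zq l : Z l <= T%:R * ext_mean M l + q l.
  by rewrite addrC -lerBlDr; exact: (mean_perf_le_queue run bnd).
have gZ : \sum_l g l * Z l <= T%:R * (\sum_l g l * ext_mean M l) + \sum_l g l * q l.
  rewrite mulr_sumr -big_split /=; apply: ler_sum => l _.
  have := ler_wpM2l (g0 l) (Zq l); lra.
(* The penalty can undercut [f] only at the expense of the constraints, whose excess is in turn paid
   by the queues. *)
have gap : T%:R * f - Y <= \sum_l g l * q l + C2.
  by move: dual gZ; rewrite /Y /Z; lra.
have sumsq : \sum_l sq l <= 2 * V * (\sum_l g l * q l + C2) + C1 * (V + T%:R).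
  have := ler_wpM2l (ltW V0) gap; move: drift; rewrite -/C1 -/Y /sq; lra.
have s1 : 1 <= s by exact: le_trans Vs.
have qb := mean_queue_bound g0 q0 sq_low C10 C20 s1
  (introT andP (conj (ltW V0) Vs)) Ts sumsq.
split=> [|l].
- rewrite (avg_penaltyE run bnd) fE -EFinD lee_fin -/Y ler_pdivrMl//.
  have sq0 : 0 <= \sum_l sq l.
    by apply: sumr_ge0 => l _; apply: Rintegral_ge0 => w _; exact: sqr_ge0.
  have drift' : V * Y <= V * (f * T%:R) + C1 * (V + T%:R).
    have h : 0 <= C1 * (V + T%:R) by rewrite mulr_ge0// addr_ge0// ltW.
    by move: drift; rewrite -/C1 -/Y -/sq; lra.
  have := ler_wpM2l (ltW e0) drift'.
  have eV (z : R) : eps * (V * z) = z by rewrite mulrA [eps * V]mulrC Ve mul1r.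
  rewrite mulrDr !eV [eps * (C1 * _)]mulrCA mulrDr -[eps * V]mulrC.
  rewrite [V * eps]Ve -/s => le1.
  (* After multiplication by [eps] the drift error is [C1 * (1 + s)], at most [2 * C1 * s] because
     [1 <= s]; the summand [2 * C1] of [C3] covers it. *)
  have h1 : C1 * 1 <= C1 * s by rewrite ler_wpM2l.
  have h2 : 0 <= (L%:R * (1 + \sum_l g l) ^+ 2 + 2 * C2) * s.
    apply: mulr_ge0; last exact: le_trans s1.
    by apply: addr_ge0; apply: mulr_ge0 => //; exact: sqr_ge0.
  have -> : T%:R * (f + (C1 + C3) * eps) = f * T%:R + (C1 + C3) * s.
    by rewrite /s; ring.
  have h3 : 0 <= C1 * s by rewrite mulr_ge0// (le_trans ler01).
  by move: h2; rewrite /C3; lra.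
- rewrite (avg_perfE run bnd) lee_fin -/(Z l) ler_pdivrMl//.
  (* The constraint violation up to [T] is at most the mean queue, hence at most [s * C3]; division
     by [T] turns [s] into [eps]. *)
  apply: le_trans (Zq l) _; rewrite mulrDr lerD2l.
  apply: le_trans (qb l) _; rewrite -/C3 /s.
  have : 0 <= eps * T%:R * C1 by rewrite !mulr_ge0// ltW.
  lra.
Qed.
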